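(* For any integer $k\geqslant 1$, if $\check{\mathcal{Z}}_*((\mathbb{Z}_2)^k)$ is not finitely generated as a $\mathbb{Z}_2$-algebra, then $\mathcal{Z}_*((\mathbb{Z}_2)^l)$ is not finitely generated as a $\mathbb{Z}_2$-algebra for some integer $l$ with $1\leqslant l\leqslant k$.
   Context: All manifolds are closed and smooth (not necessarily connected) and all group actions on them are smooth. $\check{\mathcal{Z}}_n((\mathbb{Z}_2)^k)$ is the (unoriented) equivariant bordism group of closed $n$-dimensional manifolds with $(\mathbb{Z}_2)^k$-actions having only isolated fixed points (two such manifolds are identified if their disjoint union is equivariantly the boundary of a compact smooth $(n+1)$-manifold with smooth $(\mathbb{Z}_2)^k$-action). $\check{\mathcal{Z}}_*((\mathbb{Z}_2)^k)=\bigoplus_{n\in\mathbb{N}}\check{\mathcal{Z}}_n((\mathbb{Z}_2)^k)$ is a commutative graded $\mathbb{Z}_2$-algebra: addition is disjoint union, multiplication is Cartesian product with diagonal action, and the unit is the class of a point. $\mathcal{Z}_n((\mathbb{Z}_2)^k)$ is the subgroup of $\check{\mathcal{Z}}_n((\mathbb{Z}_2)^k)$ generated by classes represented by connected $n$-manifolds with effective $(\mathbb{Z}_2)^k$-actions with only isolated fixed points, and $\mathcal{Z}_*((\mathbb{Z}_2)^k)=\bigoplus_{n\in\mathbb{N}}\mathcal{Z}_n((\mathbb{Z}_2)^k)$, a subalgebra of $\check{\mathcal{Z}}_*((\mathbb{Z}_2)^k)$; by convention its degree-$0$ part is $\mathbb{Z}_2$, spanned by the unit. *)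

(* Defs.v *)
From HB Require Import structures.
From Stdlib Require Import Relations.
From mathcomp Require Import all_boot all_order all_algebra.
From mathcomp Require Import all_classical all_reals all_analysis.

Set Implicit Arguments.
Unset Strict Implicit.
Unset Printing Implicit Defensive.

Import Order.TTheory GRing.Theory Num.Theory.
Import numFieldNormedType.Exports.

Local Open Scope classical_set_scope.
Local Open Scope ring_scope.

Section SmoothMaps.
Context {R : realType}.

(* C^p on U (meant for open U), coordinate direction by coordinate direction *)
Fixpoint class_C (p : nat) {m n : nat} (U : set 'rV[R]_m)
    (f : 'rV[R]_m -> 'rV[R]_n) : Prop :=
  if p is q.+1 then
    (forall i x, U x -> derivable f x (delta_mx 0 i)) /\
    (forall i, class_C q U (fun x => 'D_(delta_mx 0 i) f x))
  else forall x, U x -> {for x, continuous f}.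

(* A map on an arbitrary subset A of R^m is smooth when it extends, near each
   point of A, to a C^oo map on an open set; this is the usual convention on
   relatively open subsets of a half space. *)
Definition smooth_on {m n : nat} (A : set 'rV[R]_m)
    (f : 'rV[R]_m -> 'rV[R]_n) : Prop :=
  forall x, A x -> exists (U : set 'rV[R]_m) (g : 'rV[R]_m -> 'rV[R]_n),
    [/\ open U, U x, forall p, class_C p U g
      & forall y, U y -> A y -> f y = g y].

Lemma eq_class_C p m n (U : set 'rV[R]_m) (f g : 'rV[R]_m -> 'rV[R]_n) :
  f = g -> class_C p U f -> class_C p U g.
Proof. by move=> ->. Qed.

Lemma eq_in_class_C p m n (U : set 'rV[R]_m) (f g : 'rV[R]_m -> 'rV[R]_n) :
  open U -> (forall x, U x -> f x = g x) -> class_C p U f -> class_C p U g.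
Proof.
move=> oU; elim: p f g => [|p IH] f g fg.
  move=> cf x Ux; have gf : \near x, f x = g x.
    by apply: filterS (open_nbhs_nbhs (conj oU Ux)) => y; exact: fg.
  rewrite /prop_for /continuous_at -fg//.
  exact: (cvg_trans (near_eq_cvg gf) (cf x Ux)).
have fgx x : U x -> \near x, f x = g x.
  by move=> Ux; apply: filterS (open_nbhs_nbhs (conj oU Ux)) => y; exact: fg.
move=> [df Cf]; split=> [i x Ux|i].
  by apply: near_eq_derivable (df i x Ux) => //; exact: fgx.
by apply: IH (Cf i) => x Ux; apply: near_eq_derive => //; exact: fgx.
Qed.

Lemma class_C_cst p m n (U : set 'rV[R]_m) (a : 'rV[R]_n) :
  class_C p U (fun=> a).
Proof.
elim: p a => [|p IH] a /=; first by move=> x _; exact: cst_continuous.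
split=> [i x _|i]; first exact: derivable_cst.
apply: eq_class_C (IH 0); apply/funext => x.
by rewrite -[in RHS](_ : cst a = fun=> a)// derive_cst.
Qed.

Lemma class_C_id p m (U : set 'rV[R]_m) : class_C p U id.
Proof.
case: p => [|p] /=; first by move=> x _; exact: cvg_id.
split=> [i x _|i]; first exact: derivable_id.
apply: eq_class_C (class_C_cst p U (delta_mx 0 i)); apply/funext => x.
by rewrite derive_id.
Qed.

Lemma smooth_on_id m (A : set 'rV[R]_m) : smooth_on A id.
Proof.
move=> x Ax; exists setT, id; split=> //; first exact: openT.
by move=> p; exact: class_C_id.
Qed.

Lemma sub_smooth_on m n (A B : set 'rV[R]_m) (f g : 'rV[R]_m -> 'rV[R]_n) :
  A `<=` B -> (forall x, A x -> f x = g x) -> smooth_on B g -> smooth_on A f.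
Proof.
move=> AB fg sg x Ax; have [U [h [oU Ux sh gh]]] := sg x (AB x Ax).
exists U, h; split=> // y Uy Ay; rewrite fg// gh//; exact: AB.
Qed.

(* A x B inside R^(m + n) *)
Definition rV_setX {m n : nat} (A : set 'rV[R]_m) (B : set 'rV[R]_n) :
    set 'rV[R]_(m + n) :=
  [set v | A (lsubmx v) /\ B (rsubmx v)].

Definition rV_prod {m n m' n' : nat} (f : 'rV[R]_m -> 'rV[R]_m')
    (g : 'rV[R]_n -> 'rV[R]_n') (v : 'rV[R]_(m + n)) : 'rV[R]_(m' + n') :=
  row_mx (f (lsubmx v)) (g (rsubmx v)).


Lemma class_CD p m n (U : set 'rV[R]_m) (f g : 'rV[R]_m -> 'rV[R]_n) :
  open U -> class_C p U f -> class_C p U g -> class_C p U (f \+ g).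
Proof.
move=> oU; elim: p f g => [|p IH] f g /=.
  by move=> cf cg x Ux; apply: (@continuousD _ _ _ f g x); [exact: cf|exact: cg].
move=> [df Cf] [dg Cg]; split=> [i x Ux|i].
  by apply: derivableD; [exact: df|exact: dg].
apply: (@eq_in_class_C p m n U
  (('D_(delta_mx 0 i) f) \+ ('D_(delta_mx 0 i) g))) => //; last exact: IH.
by move=> x Ux /=; rewrite deriveD//; [exact: df|exact: dg].
Qed.

Lemma derive_linear_sandwich m m' n n' (pr : {linear 'rV[R]_m' -> 'rV[R]_m})
    (L : {linear 'rV[R]_n -> 'rV[R]_n'}) (f : 'rV[R]_m -> 'rV[R]_n) v e :
  continuous L -> derivable f (pr v) (pr e) ->
  is_derive v e (L \o f \o pr) (L ('D_(pr e) f (pr v))).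
Proof.
move=> cL df.
set q := fun h : R => h^-1 *: ((f \o shift (pr v)) (h *: pr e) - f (pr v)).
have qE : (fun h : R => h^-1 *: (((L \o f \o pr) \o shift v) (h *: e)
    - (L \o f \o pr) v)) = L \o q.
  by apply/funext => h; rewrite /q /= -(linearP pr) -(linearB L) -(linearZZ L).
have cq : L \o q @ 0^' --> L ('D_(pr e) f (pr v)).
  by apply: (@cvg_comp _ _ _ q L); [exact: df|exact: cL].
split; first by rewrite /derivable qE; apply: cvgP cq.
by rewrite /derive qE; exact: cvg_lim cq.
Qed.

Lemma class_C_sandwich p m m' n n' (pr : {linear 'rV[R]_m' -> 'rV[R]_m})
    (L : {linear 'rV[R]_n -> 'rV[R]_n'}) (U : set 'rV[R]_m)
    (f : 'rV[R]_m -> 'rV[R]_n) :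
  continuous pr -> continuous L -> open U ->
  (forall i, pr (delta_mx 0 i) = 0 \/ exists j, pr (delta_mx 0 i) = delta_mx 0 j) ->
  class_C p U f -> class_C p (pr @^-1` U) (L \o f \o pr).
Proof.
move=> cpr cL oU prE; have oV : open (pr @^-1` U).
  by apply: open_comp => // x _; exact: cpr.
elim: p f => [|p IH] f /=.
  move=> cf v Uv; apply: continuous_comp; first exact: cpr.
  by apply: continuous_comp; [exact: cf|exact: cL].
move=> [df Cf].
have dpr i v : U (pr v) -> derivable f (pr v) (pr (delta_mx 0 i)).
  move=> Uv; have [->|[j ->]] := prE i; last exact: df.
  exact: derivable0.
split=> [i v Uv|i].
  by have [] := derive_linear_sandwich cL (dpr i v Uv).
apply: (@eq_in_class_C p _ _ _
  (L \o (fun x => 'D_(pr (delta_mx 0 i)) f x) \o pr)) => //.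
  by move=> v Uv /=; have [_ <-] := derive_linear_sandwich cL (dpr i v Uv).
apply: IH; have [->|[j ->]] := prE i; last exact: Cf.
by apply: eq_class_C (class_C_cst p U 0); apply/funext => x; rewrite derive0.
Qed.


Lemma continuous_row_mxl m n :
  continuous (fun x : 'rV[R]_m => row_mx x (0 : 'rV[R]_n)).
Proof.
move=> u A /nbhs_ballP[e /= e0 eA]; apply/nbhs_ballP; exists e => //= v [_ uv].
apply: eA; split=> // i j; rewrite -(splitK j); case: (fintype.split j) => {}j /=.
  by rewrite !row_mxEl; exact: uv.
by rewrite !row_mxEr !mxE; exact: ballxx.
Qed.

Lemma continuous_row_mxr m n :
  continuous (fun x : 'rV[R]_n => row_mx (0 : 'rV[R]_m) x).
Proof.
move=> u A /nbhs_ballP[e /= e0 eA]; apply/nbhs_ballP; exists e => //= v [_ uv].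
apply: eA; split=> // i j; rewrite -(splitK j); case: (fintype.split j) => {}j /=.
  by rewrite !row_mxEl !mxE; exact: ballxx.
by rewrite !row_mxEr; exact: uv.
Qed.

Lemma row_mxDE m n (x : 'rV[R]_m) (y : 'rV[R]_n) :
  row_mx x y = row_mx x 0 + row_mx 0 y.
Proof. by rewrite add_row_mx addr0 add0r. Qed.

Lemma lsubmx_delta m n (i : 'I_(m + n)) :
  lsubmx (delta_mx 0 i : 'rV[R]_(m + n)) = 0 \/
  exists j, lsubmx (delta_mx 0 i : 'rV[R]_(m + n)) = delta_mx 0 j.
Proof.
rewrite -(splitK i); case: (fintype.split i) => {}i /=; last left.
  by right; exists i; apply/rowP => j; rewrite !mxE (inj_eq (@lshift_inj _ _)).
by apply/rowP => j; rewrite !mxE eq_lrshift andbF.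
Qed.

Lemma rsubmx_delta m n (i : 'I_(m + n)) :
  rsubmx (delta_mx 0 i : 'rV[R]_(m + n)) = 0 \/
  exists j, rsubmx (delta_mx 0 i : 'rV[R]_(m + n)) = delta_mx 0 j.
Proof.
rewrite -(splitK i); case: (fintype.split i) => {}i /=; first left.
  by apply/rowP => j; rewrite !mxE eq_rlshift andbF.
by right; exists i; apply/rowP => j; rewrite !mxE (inj_eq (@rshift_inj _ _)).
Qed.

Lemma open_rV_setX m n (U : set 'rV[R]_m) (V : set 'rV[R]_n) :
  open U -> open V -> open (rV_setX U V).
Proof.
move=> oU oV; apply: openI; apply: open_comp => // x _.
  exact: continuous_lsubmx.
exact: continuous_rsubmx.
Qed.

Lemma class_C_sub p m n (U V : set 'rV[R]_m) (f : 'rV[R]_m -> 'rV[R]_n) :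
  U `<=` V -> class_C p V f -> class_C p U f.
Proof.
move=> UV; elim: p f => [|p IH] f /=; first by move=> cf x /UV; exact: cf.
move=> [df Cf]; split=> [i x /UV|i]; first exact: df.
exact: IH.
Qed.

Lemma class_C_prod p m n m' n' (U : set 'rV[R]_m) (V : set 'rV[R]_n)
    (f : 'rV[R]_m -> 'rV[R]_m') (g : 'rV[R]_n -> 'rV[R]_n') :
  open U -> open V -> class_C p U f -> class_C p V g ->
  class_C p (rV_setX U V) (rV_prod f g).
Proof.
move=> oU oV Cf Cg.
have linl : linear (fun x : 'rV[R]_m' => row_mx x (0 : 'rV[R]_n')).
  by move=> a x y; rewrite scale_row_mx add_row_mx scaler0 addr0.
have linr : linear (fun x : 'rV[R]_n' => row_mx (0 : 'rV[R]_m') x).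
  by move=> a x y; rewrite scale_row_mx add_row_mx scaler0 addr0.
pose Ll : {linear 'rV[R]_m' -> 'rV[R]_(m' + n')} :=
  HB.pack (fun x : 'rV[R]_m' => row_mx x (0 : 'rV[R]_n'))
    (GRing.isLinear.Build _ _ _ _ _ linl).
pose Lr : {linear 'rV[R]_n' -> 'rV[R]_(m' + n')} :=
  HB.pack (fun x : 'rV[R]_n' => row_mx (0 : 'rV[R]_m') x)
    (GRing.isLinear.Build _ _ _ _ _ linr).
have -> : rV_prod f g = (Ll \o f \o lsubmx) \+ (Lr \o g \o rsubmx).
  by apply/funext => v; rewrite /rV_prod row_mxDE.
apply: class_CD; first exact: open_rV_setX.
  have : class_C p (lsubmx @^-1` U) (Ll \o f \o (lsubmx : 'rV_(m + n) -> 'rV_m)).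
    apply: class_C_sandwich => //; first exact: continuous_lsubmx.
      exact: continuous_row_mxl.
    exact: lsubmx_delta.
  by apply: class_C_sub => v [].
have : class_C p (rsubmx @^-1` V) (Lr \o g \o (rsubmx : 'rV_(m + n) -> 'rV_n)).
  apply: class_C_sandwich => //; first exact: continuous_rsubmx.
    exact: continuous_row_mxr.
  exact: rsubmx_delta.
by apply: class_C_sub => v [].
Qed.

Lemma smooth_on_prod m n m' n' (A : set 'rV[R]_m) (B : set 'rV[R]_n)
    (f : 'rV[R]_m -> 'rV[R]_m') (g : 'rV[R]_n -> 'rV[R]_n') :
  smooth_on A f -> smooth_on B g -> smooth_on (rV_setX A B) (rV_prod f g).
Proof.
move=> sf sg v [Av Bv]; have [U [f' [oU Uv Cf ff']]] := sf _ Av.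
have [V [g' [oV Vv Cg gg']]] := sg _ Bv.
exists (rV_setX U V), (rV_prod f' g'); split=> //; first exact: open_rV_setX.
  by move=> p; exact: class_C_prod.
by move=> w [Uw Vw] [Aw Bw]; rewrite /rV_prod ff'// gg'.
Qed.

End SmoothMaps.

Section Manifolds.
Context {R : realType}.

Record chart (T : topologicalType) (d : nat) := Chart {
  cdom : set T;
  cmap :> T -> 'rV[R]_d;
  cinv : 'rV[R]_d -> T (* relevant on the image of cdom only *)
}.

(* c is a homeomorphism from the open set cdom c onto a relatively open
   subset of the model space H *)
Record is_chart (T : topologicalType) (d : nat) (H : set 'rV[R]_d)
    (c : chart T d) : Prop := IsChart {
  chart_open : open (cdom c);
  chart_image : exists2 O : set 'rV[R]_d, open O & c @` cdom c = O `&` H;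
  chartK : forall x, cdom c x -> cinv c (c x) = x;
  chart_continuous : forall x, cdom c x -> {for x, continuous c};
  chart_inv_continuous : {within c @` cdom c, continuous (cinv c)}
}.

(* Compact smooth manifolds modelled on H: closed d-manifolds for H = setT,
   compact d-manifolds with boundary for H a half space. Second countability
   follows from compactness; connectedness is not required. The atlas need not
   be maximal, and is empty for the empty manifold. *)
Record mfd (d : nat) (H : set 'rV[R]_d) := Mfd {
  carrier :> topologicalType;
  atlas : set (chart carrier d);
  atlas_chart : forall c, atlas c -> is_chart H c;
  atlas_cover : forall x, exists2 c, atlas c & cdom c x;
  atlas_smooth : forall c c', atlas c -> atlas c' ->
    smooth_on (c @` (cdom c `&` cdom c')) (c' \o cinv c);
  mfd_hausdorff : hausdorff_space carrier;
  mfd_compact : compact [set: carrier]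
}.

Definition half_space (n : nat) : set 'rV[R]_n.+1 := [set v | 0 <= v 0 0].
Arguments half_space n : clear implicits.

Definition boundary (n : nat) (W : mfd (half_space n)) : set W :=
  [set x | exists c, [/\ atlas c, cdom c x & c x 0 0 = 0]].
Arguments boundary {n} W.

Definition smooth (d e : nat) (H : set 'rV[R]_d) (K : set 'rV[R]_e)
    (M : mfd H) (N : mfd K) (f : M -> N) : Prop :=
  continuous f /\
  forall (c : chart M d) (c' : chart N e), atlas c -> atlas c' ->
    smooth_on (c @` (cdom c `&` f @^-1` cdom c')) (c' \o f \o cinv c).

Definition immersion (d e : nat) (K : set 'rV[R]_e)
    (M : mfd [set: 'rV[R]_d]) (N : mfd K) (f : M -> N) : Prop :=
  forall (c : chart M d) (c' : chart N e) (x : M), atlas c -> atlas c' ->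
    cdom c x -> cdom c' (f x) -> injective ('d (c' \o f \o cinv c) (c x)).

(* (Z_2)^k is the additive group 'rV['F_2]_k. *)
Record gmfd (k d : nat) (H : set 'rV[R]_d) := GMfd {
  base :> mfd H;
  act : 'rV['F_2]_k -> base -> base;
  act0 : forall x, act 0 x = x;
  actD : forall g h x, act (g + h) x = act g (act h x);
  act_smooth : forall g, smooth (act g)
}.

Definition fixpoints (k d : nat) (H : set 'rV[R]_d) (M : gmfd k H) : set M :=
  [set x | forall g, act g x = x].
Arguments fixpoints {k d H} M.

Definition isolated_fixpoints (k d : nat) (H : set 'rV[R]_d)
    (M : gmfd k H) : Prop :=
  forall x, fixpoints M x -> \forall y \near x, fixpoints M y -> y = x.

Definition effective (k d : nat) (H : set 'rV[R]_d) (M : gmfd k H) : Prop :=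
  forall g, (forall x : M, act g x = x) -> g = 0.

Definition equivariant (k d e : nat) (H : set 'rV[R]_d) (K : set 'rV[R]_e)
    (M : gmfd k H) (N : gmfd k K) (f : M -> N) : Prop :=
  forall g x, f (act g x) = act g (f x).

(* M is equivariantly diffeomorphic to the boundary of some compact W: a
   bijective immersion between manifolds of the same dimension n, here M and
   the boundary of W, is a diffeomorphism. The fixed points of W need not be
   isolated. *)
Definition bounds (k n : nat) (M : gmfd k [set: 'rV[R]_n]) : Prop :=
  exists (W : gmfd k (half_space n)) (f : M -> W),
    [/\ smooth f, immersion f, injective f, range f = boundary W
      & equivariant f].

Record cgmfd (k n : nat) := CGMfd {
  cgmfd_gmfd :> gmfd k [set: 'rV[R]_n];
  cgmfd_isolated : isolated_fixpoints cgmfd_gmfd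
}.

Section DisjointUnion.
Variables (d : nat) (H : set 'rV[R]_d) (I : finType) (M : I -> mfd H).

Definition dsum_chart (i : I) (c : chart (M i) d) : chart {i & M i} d :=
  Chart (existT _ i @` cdom c) (untag 0 (cmap c)) (existT _ i \o cinv c).

Definition dsum_atlas : set (chart {i & M i} d) :=
  [set c | exists i (c0 : chart (M i) d), atlas c0 /\ c = dsum_chart c0].

Lemma untag_existT (T : Type) (t : T) i (F : M i -> T) (x : M i) :
  untag t F (existT (fun j => M j) i x) = F x.
Proof.
exact: (untagE t F (erefl : tag (existT (fun j => M j : Type) i x) = i)).
Qed.

Lemma dsum_chart_image i (c : chart (M i) d) (A : set (M i)) :
  dsum_chart c @` (existT _ i @` A) = c @` A.
Proof.
apply/seteqP; split=> v.
  by move=> [_ [x Ax <-] <-]; exists x => //; rewrite /= untag_existT.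
by move=> [x Ax <-]; exists (existT _ i x); [exists x|rewrite /= untag_existT].
Qed.

Lemma dsum_is_chart i (c : chart (M i) d) :
  is_chart H c -> is_chart H (dsum_chart c).
Proof.
move=> [oc ic cK cc ccV]; split.
- exact: existT_open_map.
- by rewrite dsum_chart_image.
- by move=> _ [x cx <-] /=; rewrite untag_existT cK.
- move=> _ [x cx <-]; rewrite /prop_for /continuous_at /= untag_existT.
  move=> A /(cc x cx) cA; rewrite /nbhs /= sigT_nbhsE /=.
  apply: (@filterS _ (nbhs x) _ [set y | A (c y)] _ _ cA) => y.
  by rewrite /= untag_existT.
- rewrite dsum_chart_image => v.
  apply: (@continuous_comp (subspace (c @` cdom c)) _ _ (cinv c) (existT _ i)).
    exact: ccV.
  exact: existT_continuous.
Qed.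

End DisjointUnion.
Arguments dsum_atlas {d H I} M.

Section DisjointUnionMaps.
Variables (d e : nat) (H : set 'rV[R]_d) (K : set 'rV[R]_e) (I : finType).
Variables (M : I -> mfd H) (N : I -> mfd K) (f : forall i, M i -> N i).

Definition dsum_map (z : {i & M i}) : {i & N i} :=
  existT (fun i => N i) (projT1 z) (f (projT2 z)).

Lemma dsum_map_continuous : (forall i, continuous (@f i)) -> continuous dsum_map.
Proof.
move=> cf [i x] A nA.
exact: (cf i x [set y | A (existT (fun j => N j) i y)] nA).
Qed.

Lemma dsum_smooth_on :
  (forall i (c : chart (M i) d) (c' : chart (N i) e), atlas c -> atlas c' ->
    smooth_on (c @` (cdom c `&` @f i @^-1` cdom c')) (c' \o @f i \o cinv c)) ->
  forall c c', dsum_atlas M c -> dsum_atlas N c' ->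
    smooth_on (c @` (cdom c `&` dsum_map @^-1` cdom c'))
      (c' \o dsum_map \o cinv c).
Proof.
move=> sf _ _ [i [c [ac ->]]] [j [c' [ac' ->]]].
have [ij|ij] := eqVneq i j; last first.
  move=> v [z [[x cx <-] [y c'y yx]] _]; exfalso.
  by move: ij => /eqP; apply; have := congr1 (@projT1 _ _) yx.
move: c' ac'; case: _ / ij => c' ac'.
have := sf _ _ _ ac ac'; apply: sub_smooth_on => v /=.
  move=> [z [[x cx <-] [y c'y yx]] <-]; rewrite untag_existT.
  by exists x => //; split => //=; rewrite -(existT_inj2 yx).
by move=> _; rewrite /dsum_map /= untag_existT.
Qed.

End DisjointUnionMaps.

Section DisjointUnionManifold.
Variables (d : nat) (H : set 'rV[R]_d) (I : finType) (M : I -> mfd H).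

Lemma dsum_atlas_chart c : dsum_atlas M c -> is_chart H c.
Proof. by move=> [i [c0 [ac ->]]]; apply/dsum_is_chart/atlas_chart. Qed.

Lemma dsum_atlas_cover x : exists2 c, dsum_atlas M c & cdom c x.
Proof.
case: x => i x; have [c ac cx] := atlas_cover x.
by exists (dsum_chart c); [exists i, c|exists x].
Qed.

Lemma dsum_atlas_smooth c c' : dsum_atlas M c -> dsum_atlas M c' ->
  smooth_on (c @` (cdom c `&` cdom c')) (c' \o cinv c).
Proof.
have -> : c' \o cinv c = c' \o dsum_map (fun i => @id (M i)) \o cinv c.
  by apply/funext => v /=; case: (cinv c v).
have -> : cdom c' = dsum_map (fun i => @id (M i)) @^-1` cdom c'.
  by apply/funext => -[i x].
move: c c'; apply: dsum_smooth_on => i c c'; exact: atlas_smooth.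
Qed.

Definition dsum_mfd : mfd H.
Proof.
refine (@Mfd d H {i & M i} (dsum_atlas M) dsum_atlas_chart dsum_atlas_cover
  dsum_atlas_smooth _ _).
- by apply: sigT_hausdorff => i; exact: mfd_hausdorff.
- by apply: sigT_compact => [|i]; [exact: finite_finset|exact: mfd_compact].
Defined.

End DisjointUnionManifold.

Lemma dsum_map_smooth (d e : nat) (H : set 'rV[R]_d) (K : set 'rV[R]_e)
    (I : finType) (M : I -> mfd H) (N : I -> mfd K) (f : forall i, M i -> N i) :
  (forall i, smooth (@f i)) ->
  smooth (dsum_map f : dsum_mfd M -> dsum_mfd N).
Proof.
move=> sf; split; first by apply: dsum_map_continuous => i; have [] := sf i.
by apply: dsum_smooth_on => i; have [] := sf i.
Qed.

Definition dsum_gmfd (k d : nat) (H : set 'rV[R]_d) (I : finType)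
  (M : I -> gmfd k H) : gmfd k H.
Proof.
refine (@GMfd k d H (dsum_mfd M) (fun g => dsum_map (fun i => @act _ _ _ (M i) g))
  _ _ _).
- by case=> i x; rewrite /dsum_map /= act0.
- by move=> g h [i x]; rewrite /dsum_map /= actD.
- by move=> g; apply: dsum_map_smooth => i; exact: act_smooth.
Defined.

Definition dsum (k n : nat) (I : finType) (M : I -> cgmfd k n) : cgmfd k n.
Proof.
refine (@CGMfd k n (dsum_gmfd M) _) => -[i x] fx.
have {}fx : fixpoints (M i) x by move=> g; exact: (existT_inj2 (fx g)).
have := cgmfd_isolated fx => isx.
apply: (@filterS _ (nbhs x) _ [set y | fixpoints (M i) y -> y = x]) => // y yx fy.
by congr existT; apply: yx => g; exact: (existT_inj2 (fy g)).
Defined.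

Section Product.
Variables (d e : nat).

Definition prod_chart (S T : topologicalType) (c : chart S d) (c' : chart T e) :
    chart (S * T)%type (d + e) :=
  Chart (cdom c `*` cdom c') (fun x => row_mx (c x.1) (c' x.2))
    (fun v => (cinv c (lsubmx v), cinv c' (rsubmx v))).

Lemma prod_chart_image (S T : topologicalType) (c : chart S d) (c' : chart T e)
    (A : set S) (B : set T) :
  prod_chart c c' @` (A `*` B) = rV_setX (c @` A) (c' @` B).
Proof.
apply/seteqP; split=> v.
  move=> [] [x y] [Ax By] <-; rewrite /rV_setX /= row_mxKl row_mxKr.
  by split; [exists x|exists y].
move=> [] [x Ax xv] [y By yv]; exists (x, y) => //=.
by rewrite xv yv hsubmxK.
Qed.

Lemma prod_is_chart (S T : topologicalType) (H : set 'rV[R]_d)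
    (K : set 'rV[R]_e) (c : chart S d) (c' : chart T e) :
  is_chart H c -> is_chart K c' -> is_chart (rV_setX H K) (prod_chart c c').
Proof.
move=> [oc [U oU cU] cK cc ccV] [oc' [U' oU' cU'] cK' cc' ccV']; split.
- rewrite openE; case=> x y [] /= cx cy; exists (cdom c, cdom c') => //=.
  by split; exact: open_nbhs_nbhs.
- rewrite prod_chart_image cU cU'; exists (rV_setX U U').
    exact: open_rV_setX.
  by apply/seteqP; split=> v; [move=> [[? ?] [? ?]]|move=> [[? ?] [? ?]]].
- by case=> x y [] /= cx cy; rewrite row_mxKl row_mxKr cK// cK'.
- case=> x y [] /= cx cy; rewrite /prop_for /continuous_at /=.
  rewrite [X in _ --> X]row_mxDE.
  rewrite [X in X @ _](_ : _ = ((fun u => row_mx u 0) \o c \o fst) \+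
    ((fun u => row_mx 0 u) \o c' \o snd)); last first.
    by apply/funext => z /=; rewrite row_mxDE.
  apply: cvgD.
    apply: (@cvg_comp _ _ _ fst ((fun u => row_mx u 0) \o c) _ (nbhs x)).
      exact: cvg_fst.
    apply: (@cvg_comp _ _ _ c (fun u => row_mx u 0) _ (nbhs (c x))).
      exact: cc.
    exact: continuous_row_mxl.
  apply: (@cvg_comp _ _ _ snd ((fun u => row_mx 0 u) \o c') _ (nbhs y)).
    exact: cvg_snd.
  apply: (@cvg_comp _ _ _ c' (fun u => row_mx 0 u) _ (nbhs (c' y))).
    exact: cc'.
  exact: continuous_row_mxr.
- rewrite prod_chart_image; apply/subspace_continuousP => v [cv cv'].
  have lim := (subspace_continuousP _ _).1 ccV _ cv.
  have lim' := (subspace_continuousP _ _).1 ccV' _ cv'.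
  apply: cvg_pair => /= A nA.
    have h := continuous_lsubmx (lim _ nA).
    by apply: (@filterS _ (nbhs v) _ _ _ _ h) => w Aw [cw _]; exact: Aw.
  have h := continuous_rsubmx (lim' _ nA).
  by apply: (@filterS _ (nbhs v) _ _ _ _ h) => w Aw [_ cw]; exact: Aw.
Qed.

Variables (M : mfd [set: 'rV[R]_d]) (N : mfd [set: 'rV[R]_e]).

Definition prod_atlas : set (chart (M * N)%type (d + e)) :=
  [set c | exists (c1 : chart M d) (c2 : chart N e),
    [/\ atlas c1, atlas c2 & c = prod_chart c1 c2]].

Lemma prod_atlas_chart c :
  prod_atlas c -> is_chart [set: 'rV[R]_(d + e)] c.
Proof.
move=> [c1 [c2 [ac1 ac2 ->]]].
have -> : [set: 'rV[R]_(d + e)] = rV_setX setT setT by apply/seteqP.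
by apply: prod_is_chart; exact: atlas_chart.
Qed.

Lemma prod_atlas_cover x : exists2 c, prod_atlas c & cdom c x.
Proof.
have [c1 ac1 cx1] := atlas_cover x.1; have [c2 ac2 cx2] := atlas_cover x.2.
by exists (prod_chart c1 c2) => //; exists c1, c2.
Qed.

End Product.
Arguments prod_atlas {d e} M N.

Definition prod_map (S S' T T' : Type) (f : S -> S') (g : T -> T')
  (x : S * T) : S' * T' := (f x.1, g x.2).

Lemma prod_smooth_on (d e d' e' : nat) (M : mfd [set: 'rV[R]_d])
    (N : mfd [set: 'rV[R]_e]) (M' : mfd [set: 'rV[R]_d'])
    (N' : mfd [set: 'rV[R]_e']) (f : M -> M') (g : N -> N') :
  (forall (c : chart M d) (c' : chart M' d'), atlas c -> atlas c' ->
    smooth_on (c @` (cdom c `&` f @^-1` cdom c')) (c' \o f \o cinv c)) ->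
  (forall (c : chart N e) (c' : chart N' e'), atlas c -> atlas c' ->
    smooth_on (c @` (cdom c `&` g @^-1` cdom c')) (c' \o g \o cinv c)) ->
  forall c c', prod_atlas M N c -> prod_atlas M' N' c' ->
    smooth_on (c @` (cdom c `&` prod_map f g @^-1` cdom c'))
      (c' \o prod_map f g \o cinv c).
Proof.
move=> sf sg _ _ [c [b [ac ab ->]]] [c' [b' [ac' ab' ->]]].
apply: sub_smooth_on (smooth_on_prod (sf _ _ ac ac') (sg _ _ ab ab')) => //.
move=> _ [[x y] [[/= cx bY] [c'x b'y]] <-].
rewrite /rV_setX /= row_mxKl row_mxKr.
by split; [exists x|exists y].
Qed.

Lemma prod_atlas_smooth (d e : nat) (M : mfd [set: 'rV[R]_d])
    (N : mfd [set: 'rV[R]_e]) c c' :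
  prod_atlas M N c -> prod_atlas M N c' ->
  smooth_on (c @` (cdom c `&` cdom c')) (c' \o cinv c).
Proof.
move=> ac ac'.
have -> : c' \o cinv c = c' \o prod_map (@id M) (@id N) \o cinv c.
  by apply/funext => v /=; case: (cinv c v).
have -> : cdom c' = prod_map (@id M) (@id N) @^-1` cdom c'.
  by apply/funext => -[x y].
by move: ac ac'; apply: prod_smooth_on => b b'; exact: atlas_smooth.
Qed.

Definition prod_mfd (d e : nat) (M : mfd [set: 'rV[R]_d])
  (N : mfd [set: 'rV[R]_e]) : mfd [set: 'rV[R]_(d + e)].
Proof.
refine (@Mfd (d + e) setT (M * N)%type (prod_atlas M N) (@prod_atlas_chart _ _ M N)
  (@prod_atlas_cover _ _ M N) (@prod_atlas_smooth _ _ M N) _ _).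
- move=> [x y] [x' y'] xy; congr pair.
    apply: (@mfd_hausdorff _ _ M) => A B nA nB.
    have [] := xy (fst @^-1` A) (fst @^-1` B); [exact: cvg_fst|exact: cvg_fst|].
    by move=> z [Az Bz]; exists z.1.
  apply: (@mfd_hausdorff _ _ N) => A B nA nB.
  have [] := xy (snd @^-1` A) (snd @^-1` B); [exact: cvg_snd|exact: cvg_snd|].
  by move=> z [Az Bz]; exists z.2.
- by rewrite -setXTT; apply: compact_setX; exact: mfd_compact.
Defined.

Lemma prod_map_smooth (d e d' e' : nat) (M : mfd [set: 'rV[R]_d])
    (N : mfd [set: 'rV[R]_e]) (M' : mfd [set: 'rV[R]_d'])
    (N' : mfd [set: 'rV[R]_e']) (f : M -> M') (g : N -> N') :
  smooth f -> smooth g ->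
  smooth (prod_map f g : prod_mfd M N -> prod_mfd M' N').
Proof.
move=> [cf sf] [cg sg]; split; last exact: prod_smooth_on.
move=> [x y]; apply: cvg_pair => /=.
  apply: (@cvg_comp _ _ _ fst f _ (nbhs x)); [exact: cvg_fst|exact: cf].
apply: (@cvg_comp _ _ _ snd g _ (nbhs y)); [exact: cvg_snd|exact: cg].
Qed.

(* diagonal action *)
Definition prod_gmfd (k d e : nat) (M : gmfd k [set: 'rV[R]_d])
  (N : gmfd k [set: 'rV[R]_e]) : gmfd k [set: 'rV[R]_(d + e)].
Proof.
refine (@GMfd k _ _ (prod_mfd M N) (fun g => prod_map (@act _ _ _ M g) (@act _ _ _ N g))
  _ _ _).
- by case=> x y; rewrite /prod_map /= !act0.
- by move=> g h [x y]; rewrite /prod_map /= !actD.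
- by move=> g; apply: prod_map_smooth; exact: act_smooth.
Defined.

Definition cprod (k m n : nat) (M : cgmfd k m) (N : cgmfd k n) :
  cgmfd k (m + n).
Proof.
refine (@CGMfd k _ (prod_gmfd M N) _) => -[x y] fxy.
have fx : fixpoints M x by move=> g; have [] := fxy g.
have fy : fixpoints N y by move=> g; have [] := fxy g.
exists ([set u | fixpoints M u -> u = x], [set v | fixpoints N v -> v = y]).
  by split; exact: cgmfd_isolated.
move=> [u v] [/= uE vE] fuv.
by congr pair; [apply: uE => g; have [] := fuv g|apply: vE => g; have [] := fuv g].
Defined.

Section Point.

Definition point_chart : chart 'rV[R]_0 0 := Chart setT id id.

Lemma point_is_chart : is_chart setT point_chart.
Proof.
split=> //=; first exact: openT.
- by exists setT; [exact: openT|rewrite image_id setIT].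
- by move=> x _; exact: cvg_id.
- by apply: continuous_subspaceT => x; exact: cvg_id.
Qed.

Definition point_mfd : mfd [set: 'rV[R]_0].
Proof.
refine (@Mfd 0 setT 'rV[R]_0 [set point_chart] _ _ _ _ _).
- by move=> _ ->; exact: point_is_chart.
- by move=> x; exists point_chart.
- by move=> _ _ -> ->; exact: smooth_on_id.
- exact: norm_hausdorff.
- rewrite (_ : setT = [set 0]); first exact: compact_set1.
  by apply/seteqP; split=> x // _; apply/rowP => -[].
Defined.

Definition point_gmfd (k : nat) : gmfd k [set: 'rV[R]_0].
Proof.
refine (@GMfd k 0 setT point_mfd (fun=> id) _ _ _) => // g.
split; first by move=> x; exact: cvg_id.
by move=> _ _ -> ->; exact: smooth_on_id.
Defined.

Definition cpoint (k : nat) : cgmfd k 0.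
Proof.
by refine (@CGMfd k 0 (point_gmfd k) _) => x _; near=> y => _; apply/rowP => -[].
Unshelve. all: by end_near. Defined.

End Point.

End Manifolds.

Section Bordism.
Variables (R : realType) (k : nat).

Definition disjoint_union (n : nat) (M N : @cgmfd R k n) : cgmfd k n :=
  dsum (fun b : bool => if b then M else N).

Definition empty_cgmfd (n : nat) : @cgmfd R k n :=
  dsum (fun i : void => match i with end).

Definition bordant (n : nat) (M N : @cgmfd R k n) : Prop :=
  bounds (disjoint_union M N).

(* Bordism is already an equivalence relation (transitivity is gluing along
   collars); taking the generated equivalence makes the quotient below
   meaningful without that theorem. *)
Definition bordism_eq (n : nat) : relation (@cgmfd R k n) :=
  clos_refl_sym_trans _ (@bordant n).

(* The quotient of the closed n-dimensional manifolds by bordism, as the type of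
   its equivalence classes. *)
Definition bordism_group (n : nat) : Type :=
  {C : @cgmfd R k n -> Prop | exists M, C = bordism_eq M}.

Definition bclass (n : nat) (M : @cgmfd R k n) : bordism_group n :=
  exist _ (bordism_eq M) (ex_intro _ M erefl).

Definition brepr (n : nat) (x : bordism_group n) : @cgmfd R k n :=
  projT1 (cid (proj2_sig x)).

Lemma breprK (n : nat) (x : bordism_group n) : bclass (brepr x) = x.
Proof.
by rewrite /brepr; case: cid => M; case: x => C p /= CE; exact: eq_exist.
Qed.

Lemma eq_bclassP (n : nat) (M N : @cgmfd R k n) :
  bclass M = bclass N <-> bordism_eq M N.
Proof.
split=> [[->]|MN]; first exact: rst_refl.
apply: eq_exist; apply/funext => P; apply/propext; split.
  exact/rst_trans/rst_sym.
exact/rst_trans.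
Qed.

Definition bzero (n : nat) : bordism_group n := bclass (empty_cgmfd n).

(* Bordism is a congruence for disjoint unions and products, so that the
   representatives chosen in badd and bmul are irrelevant. *)
Definition badd (n : nat) (x y : bordism_group n) : bordism_group n :=
  bclass (disjoint_union (brepr x) (brepr y)).

Definition bone : bordism_group 0 := bclass (cpoint k).

Definition bmul (m n : nat) (x : bordism_group m) (y : bordism_group n) :
    bordism_group (m + n) :=
  bclass (cprod (brepr x) (brepr y)).

(* Elements of the direct sum over n are the finitely supported families; the
   operations below make sense for all families. *)
Definition bfamily : Type := forall n, bordism_group n.

Definition fzero : bfamily := bzero.

Definition fone : bfamily :=
  fun n => if n is 0 then bone else bzero _.

Definition fadd (x y : bfamily) : bfamily := fun n => badd (x n) (y n).

Definition fmul (x y : bfamily) : bfamily := fun n =>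
  \big[@badd n/bzero n]_(i < n.+1)
    ecast j (bordism_group j) (subnKC (leq_ord i)) (bmul (x i) (y (n - i)%N)).

Definition bordism_algebra (x : bfamily) : Prop :=
  exists N, forall n, (N <= n)%N -> x n = bzero n.

(* The subgroup generated by the classes of connected effective manifolds.
   Closure under opposites is automatic: the cylinder on M shows that
   [M] + [M] = 0. *)
Inductive effective_subgroup (n : nat) : bordism_group n -> Prop :=
| effective_class (M : @cgmfd R k n) :
    connected [set: M] -> effective M -> effective_subgroup (bclass M)
| effective_zero : effective_subgroup (bzero n)
| effective_add x y :
    effective_subgroup x -> effective_subgroup y ->
    effective_subgroup (badd x y).

Definition effective_part (n : nat) : bordism_group n -> Prop :=
  match n with
  | 0 => fun x => x = bzero 0 \/ x = bone
  | n'.+1 => @effective_subgroup n'.+1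
  end.

Definition effective_algebra (x : bfamily) : Prop :=
  bordism_algebra x /\ forall n, effective_part (x n).

(* Subalgebra over Z_2 generated by the s i: the scalars being 0 and 1, it only
   has to contain 0 and to be closed under addition and multiplication. *)
Inductive generated (r : nat) (s : 'I_r -> bfamily) : bfamily -> Prop :=
| generated_gen i : generated s (s i)
| generated_zero : generated s fzero
| generated_one : generated s fone
| generated_add x y : generated s x -> generated s y -> generated s (fadd x y)
| generated_mul x y : generated s x -> generated s y -> generated s (fmul x y).

Definition finitely_generated (A : bfamily -> Prop) : Prop :=
  exists (r : nat) (s : 'I_r -> bfamily),
    (forall i, A (s i)) /\ forall x, A x -> generated s x.

End Bordism.

(* Main.v *)
Require Import Defs.
From mathcomp Require Import all_boot all_order all_algebra.
From mathcomp Require Import all_classical all_reals all_analysis.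
From mathcomp Require Import ring lra.

(** A closed manifold M with isolated fixed points is the disjoint union of the
    orbits of its components. If an orbit is not a single component C, choose t
    with tC <> C and an index two subgroup K that contains the stabilizer of C but
    not t; the orbit is then the disjoint union of N = KC and tN, that is the
    boundary of [-1, 1] x N where t reverses the segment, and its class vanishes.
    If the orbit is C itself, dividing by the kernel of the action exhibits C as
    the pullback of an effective connected manifold along a surjection
    (Z_2)^k -> (Z_2)^l; moreover l > 0 in positive dimension, as a trivial action
    has no isolated fixed points there. Pulling back along a surjection is a ring
    morphism, so the pullbacks of generators of the Z_*((Z_2)^l), 1 <= l <= k,
    along the finitely many surjections generate the whole bordism algebra. *)

Set Implicit Arguments.
Unset Strict Implicit.
Unset Printing Implicit Defensive.

Import Order.TTheory GRing.Theory Num.Theory.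
Import numFieldNormedType.Exports.

Local Open Scope classical_set_scope.
Local Open Scope ring_scope.

(** * Continuous partial derivatives imply differentiability *)

Section Differentiability.
Context {R : realType}.

(** [smooth] is phrased through iterated partial derivatives, while [immersion] speaks of the
    differential ['d], which is meaningful only for a differentiable map. Continuous partial
    derivatives therefore have to be shown to give differentiability. Precomposition is arranged so
    that the inner map is linear in charts (inclusion of a summand or of a clopen part, exchange of
    two factors); [class_C_sandwich] then takes the place of a chain rule for [class_C].

    All bordisms are made from given ones and from the segment by sums, products and pullbacks. In
    the decisive one, t exchanges the ends of the segment, and the group acts on N through its
    projection onto K along t, so that N and tN become the two ends. The subgroup K exists because
    subgroups of (Z_2)^k are linear subspaces over ['F_2]: a linear form separates t from the
    stabilizer of C, and K is its kernel. Finiteness enters twice: compactness leaves finitely many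
    orbits of components, and surjections onto (Z_2)^l are matrices over a finite field. *)

Lemma coord_le_norm m n (x : 'M[R]_(m, n)) i j : `|x i j| <= `|x|.
Proof.
rewrite [leRHS]/Num.Def.normr /= mx_normrE.
exact: (le_bigmax _ (fun ij => `|x ij.1 ij.2|) (i, j)).
Qed.

Lemma mx_norm_le m n (x : 'M[R]_(m, n)) e :
  0 <= e -> (forall i j, `|x i j| <= e) -> `|x| <= e.
Proof.
move=> e0 xe; rewrite [leLHS]/Num.Def.normr /= mx_normrE.
by apply: bigmax_le => // -[i j] _; exact: xe.
Qed.

Lemma continuous_mulmxr m n p (A : 'M[R]_(n, p)) :
  continuous (mulmxr A : 'M[R]_(m, n) -> 'M[R]_(m, p)).
Proof.
apply: bounded_linear_continuous; apply/linear_boundedP. 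
exists (\sum_i \sum_j `|A i j|); split; first by rewrite num_real.
move=> r Ar x; apply: mx_norm_le => [|i j].
  apply: mulr_ge0 => //; apply: ltW; apply: le_lt_trans Ar.
  by apply: sumr_ge0 => a _; apply: sumr_ge0.
apply: le_trans (ler_wpM2r (normr_ge0 x) (ltW Ar)).
rewrite /= mxE mulr_suml; apply: le_trans (ler_norm_sum _ _ _) _.
apply: ler_sum => a _; rewrite normrM mulrC.
apply: ler_pM => //; last exact: coord_le_norm.
by rewrite (bigD1 j)//= lerDl sumr_ge0.
Qed.

Lemma is_derive_line m (g : 'rV[R]_m -> R) y v t :
  derivable g (y + t *: v) v ->
  is_derive t (1 : R) (fun s : R => g (y + s *: v)) ('D_v g (y + t *: v)).
Proof.
move=> dg; have E : (fun h : R => h^-1 *: (((fun s : R => g (y + s *: v)) \o shift t)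
    (h *: (1 : R)) - g (y + t *: v)))
  = (fun h => h^-1 *: ((g \o shift (y + t *: v)) (h *: v) - g (y + t *: v))).
  apply/funext => h /=; congr (_ *: (g _ - _)).
  by rewrite [h *: 1]mulr1 scalerDl addrCA.
split; first by rewrite /derivable E; exact: dg.
by rewrite /derive E.
Qed.

(** This is the mean value theorem for [g (y + t *: v) - t * a], whose derivative is at most [e] in
    absolute value. The range of [t] is symmetric so as to cover both signs of [s]. *)
Lemma MVT_line m (g : 'rV[R]_m -> R) y v a e (s : R) :
  (forall t, `|t| <= `|s| -> derivable g (y + t *: v) v) ->
  (forall t, `|t| <= `|s| -> `|'D_v g (y + t *: v) - a| <= e) ->
  `|g (y + s *: v) - g y - s * a| <= `|s| * e.
Proof.
move=> dg De; pose phi t := g (y + t *: v) - t * a.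
have dphi t : `|t| <= `|s| -> is_derive t (1 : R) phi ('D_v g (y + t *: v) - a).
  move=> ts; rewrite (_ : phi = (fun s => g (y + s *: v)) - (fun t => t * a)) //.
  apply: is_deriveB; first exact/is_derive_line/dg.
  by have := @is_deriveM R R id (cst a) t 1 1 0 _ _; rewrite scaler0 add0r => H;
    apply: is_derive_eq; rewrite ?scaler1.
have mvt b c : b <= c -> (forall t, t \in `[b, c] -> `|t| <= `|s|) ->
    `|phi c - phi b| <= e * (c - b).
  move=> bc bcs.
  have [t tbc ->] := @MVT_segment R phi (fun t => 'D_v g (y + t *: v) - a) b c bc
    (fun t tbc => dphi t (bcs t (subset_itv_oo_cc tbc)))
    (@derivable_within_continuous _ _ phi `[b, c]
      (fun t tbc => ex_derive (is_derive := dphi t (bcs t tbc)))).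
  rewrite normrM [X in _ * X]ger0_norm ?subr_ge0//.
  by apply: ler_wpM2r; rewrite ?subr_ge0//; exact/De/bcs.
have phi0 : phi 0 = g y by rewrite /phi scale0r addr0 mul0r subr0.
have -> : g (y + s *: v) - g y - s * a = phi s - phi 0.
  by rewrite phi0 /phi addrAC.
have [s0|s0] := leP 0 s.
  have := mvt 0 s s0; rewrite subr0 mulrC (ger0_norm s0); apply.
  by move=> t; rewrite in_itv /= => /andP[t0 ts]; rewrite ger0_norm.
have := mvt s 0 (ltW s0); rewrite distrC sub0r mulrC (ltr0_norm s0); apply.
by move=> t; rewrite in_itv /= => /andP[t0 ts]; rewrite ler0_norm// lerN2.
Qed.

(** The path from [x] to [x + h] changes one coordinate at a time, [hh j] retaining the first [j]
    coordinates of [h]; [MVT_line] bounds each step by [|h| * e]. As the norm is the maximum norm,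
    the path stays within distance [|h|] of [x]. *)
Lemma partials_increment m (g : 'rV[R]_m -> R) x (a : 'I_m -> R) e h :
  (forall y i, `|y - x| <= `|h| -> derivable g y (delta_mx 0 i)) ->
  (forall y i, `|y - x| <= `|h| -> `|'D_(delta_mx 0 i) g y - a i| <= e) ->
  `|g (x + h) - g x - \sum_i h 0 i * a i| <= `|h| * (m%:R * e).
Proof.
move=> dg De.
pose hh j : 'rV[R]_m := \row_i (if (i < j)%N then h 0 i else 0).
suff H j : (j <= m)%N ->
    `|g (x + hh j) - g x - \sum_(i < m | (i < j)%N) h 0 i * a i| <= `|h| * (j%:R * e).
  have := H m (leqnn m); rewrite (_ : hh m = h); last first.
    by apply/rowP => i; rewrite mxE ltn_ord.
  by under eq_bigl do rewrite ltn_ord.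
elim: j => [|j IH] jm.
  rewrite big_pred0// (_ : hh 0%N = 0) ?addr0 ?subrr ?normr0 ?mul0r ?mulr0//.
  by apply/rowP => i; rewrite !mxE.
pose i0 := Ordinal jm.
have hhS : hh j.+1 = hh j + h 0 i0 *: delta_mx 0 i0.
  apply/rowP => i; rewrite !mxE /= ltnS leq_eqVlt -(inj_eq val_inj) /=.
  by case: eqVneq => [/= ij|_]/=; rewrite ?ij ?ltnn ?mulr1 ?add0r ?mulr0 ?addr0//
    (_ : i = i0)//; exact: val_inj.
have near t : `|t| <= `|h 0 i0| ->
    `|(x + hh j) + t *: delta_mx 0 i0 - x| <= `|h|.
  move=> th; have -> : forall u v : 'rV[R]_m, x + u + v - x = u + v.
    by move=> u v; rewrite [LHS]addrC -addrA addKr.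
  apply: mx_norm_le => // i1 i; rewrite !mxE !ord1 /= -(inj_eq val_inj) /=.
  case: (eqVneq (i : nat) j) => [->|_]; first rewrite ltnn mulr1 add0r.
    exact: le_trans th (coord_le_norm _ _ _).
  rewrite mulr0 addr0.
  by case: ifP => _; rewrite ?normr0// coord_le_norm.
have := @MVT_line m g (x + hh j) (delta_mx 0 i0) (a i0) e (h 0 i0)
  (fun t th => dg _ _ (near t th)) (fun t th => De _ _ (near t th)).
have {}IH := IH (ltnW jm); rewrite -[x + hh j + _]addrA -hhS => step.
have -> : \sum_(i < m | (i < j.+1)%N) h 0 i * a i =
    \sum_(i < m | (i < j)%N) h 0 i * a i + h 0 i0 * a i0.
  rewrite (bigD1 i0) ?ltnS//= addrC; congr (_ + _); apply: eq_bigl => i.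
  by rewrite ltnS -(inj_eq val_inj) /= andbC ltn_neqAle.
rewrite (_ : _ - _ = (g (x + hh j.+1) - g (x + hh j) - h 0 i0 * a i0) +
    (g (x + hh j) - g x - \sum_(i < m | (i < j)%N) h 0 i * a i)); last by ring.
apply: le_trans (ler_normD _ _) _; rewrite -natr1 addrC mulrDl mul1r mulrDr.
apply: lerD => //; apply: le_trans step _; apply: ler_wpM2r.
  by apply: le_trans (normr_ge0 _) (De x i0 _); rewrite subrr normr0.
exact: coord_le_norm.
Qed.

(** [differentiable] refers to the chosen differential ['d f x]. Uniqueness identifies it with any
    candidate [L] satisfying the first-order estimate. *)
Lemma differentiable_near (V W : normedModType R) (f : V -> W)
    (L : {linear V -> W}) x : continuous L ->
  (forall e : R, 0 < e ->
    \forall h \near 0, `|f (x + h) - f x - L h| <= e * `|h|) ->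
  differentiable f x.
Proof.
move=> cL fL; have E : f \o shift x = cst (f x) + L +o_ 0 id.
  apply/eqaddoP => e e0; apply: filterS (fL e e0) => h.
  by rewrite -[((f \o _) - _) h]/(f (h + x) - (f x + L h)) opprD addrA [h + x]addrC.
by apply/diff_locallyP; rewrite (diff_unique cL E).
Qed.

Lemma class_C1_differentiable m n (U : set 'rV[R]_m) (f : 'rV[R]_m -> 'rV[R]_n) x :
  open U -> class_C 1 U f -> U x -> differentiable f x.
Proof.
move=> oU [df cf] Ux.
pose J : 'M[R]_(m, n) := \matrix_i 'D_(delta_mx 0 i) f x.
pose L : {linear 'rV[R]_m -> 'rV[R]_n} := mulmxr J.
have cL : continuous L by exact: continuous_mulmxr.
apply: (@differentiable_near _ _ _ L) => // e e0.
(* Each of the [m] coordinates contributes one such error, for a total of at most [e]; dividing by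
   [m.+1] keeps the quotient meaningful for [m = 0]. *)
have : \forall y \near x, U y /\ forall i,
    `|'D_(delta_mx 0 i) f x - 'D_(delta_mx 0 i) f y| <= e / m.+1%:R.
  apply: filterI; first exact: open_nbhs_nbhs.
  apply: (@filter_forall _ _ (fun i y =>
    `|'D_(delta_mx 0 i) f x - 'D_(delta_mx 0 i) f y| <= e / m.+1%:R) (nbhs x)) => i.
  have /cvgrPdist_le := cf i x Ux; apply.
  by rewrite divr_gt0.
move=> /nbhs_ballP[r /= r0 Hr].
have : \forall h \near (0 : 'rV[R]_m), `|h| < r by apply/nbhs_norm0P; exists r.
apply: filterS => h hr; apply: mx_norm_le => [|a j]; first by rewrite mulr_ge0 ?normr_ge0 ?(ltW e0).
rewrite ord1 {a}.
have xr y : `|y - x| <= `|h| -> ball x r y.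
  by move=> yh; rewrite -ball_normE /= distrC; exact: le_lt_trans hr.
have fj y i : `|y - x| <= `|h| -> derivable f y (delta_mx 0 i).
  by move=> /xr/Hr[Uy _]; exact: df.
have := @partials_increment m (fun y => f y 0 j) x (fun i => 'D_(delta_mx 0 i) f x 0 j)
  (e / m.+1%:R) h _ _.
have -> : (f (x + h) - f x - L h) 0 j =
    f (x + h) 0 j - f x 0 j - \sum_i h 0 i * 'D_(delta_mx 0 i) f x 0 j.
  by rewrite !mxE; congr (_ - _); apply: eq_bigr => i _; rewrite mxE.
move=> H; apply: le_trans (H _ _) _.
- by move=> y i /fj /derivable_mxP; apply.
- move=> y i yh; have := (Hr y (xr y yh)).2 i; apply: le_trans.
  have -> : 'D_(delta_mx 0 i) (fun y => f y 0 j) y = 'D_(delta_mx 0 i) f y 0 j.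
    by rewrite (derive_mx (fj y i yh)) mxE.
  by rewrite distrC; have := coord_le_norm ('D_(delta_mx 0 i) f x - 'D_(delta_mx 0 i) f y) 0 j;
    rewrite !mxE.
rewrite [leRHS]mulrC; apply: ler_wpM2l => //.
by rewrite mulrCA ler_piMr ?(ltW e0)// ler_pdivrMr// mul1r ler_nat.
Qed.

End Differentiability.

(** * Locality of differentials and of smoothness *)

Section NearEquality.
Context {R : realType}.

Lemma near_eq_differentiable (V W : normedModType R) (f g : V -> W) x :
  (\near x, f x = g x) -> differentiable g x -> differentiable f x.
Proof.
move=> fg dg; apply: (@differentiable_near _ _ _ _ ('d g x)).
  exact: diff_continuous.
move=> e e0; have fg0 : \forall h \near 0, f (x + h) = g (x + h).
  by rewrite -(@nbhs0P _ _ (fun y => f y = g y) x).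
have fgx : f x = g x := nbhs_singleton fg.
have /diff_locally /eqaddoP /(_ e e0) dgx := dg.
apply: filterS2 fg0 dgx => h fgh.
by rewrite -[((g \o _) - _) h]/(g (h + x) - (g x + 'd g x h)) fgh fgx opprD addrA
  [h + x]addrC.
Qed.

Lemma near_eq_diff (V W : normedModType R) (f g : V -> W) x :
  (\near x, f x = g x) -> differentiable g x -> 'd f x = 'd g x :> (V -> W).
Proof.
move=> fg dg; apply/funext => v.
have [->|v0] := eqVneq v 0; first by rewrite !linear0.
by rewrite -!deriveE//; [exact: near_eq_derive|exact: near_eq_differentiable fg dg].
Qed.

(** Smoothness on a set is local in both the map and the set: near each point, [A] only has to lie
    in a set [A'] on which a comparison map is smooth. *)
Lemma smooth_on_near m n (A : set 'rV[R]_m) (f : 'rV[R]_m -> 'rV[R]_n) :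
  (forall x, A x -> exists (B A' : set 'rV[R]_m) (g : 'rV[R]_m -> 'rV[R]_n),
    [/\ nbhs x B, smooth_on A' g, A' x
      & forall y, B y -> A y -> A' y /\ f y = g y]) ->
  smooth_on A f.
Proof.
move=> H x Ax; have [B [A' [g [nB sg A'x fg]]]] := H x Ax.
have [U [h [oU Ux Ch gh]]] := sg x A'x.
move: nB; rewrite nbhsE => -[V [oV Vx] VB].
exists (U `&` V), h; split => //; first exact: openI.
  by move=> p; apply: class_C_sub (Ch p) => y [].
by move=> y [Uy Vy] Ay; have [A'y ->] := fg y (VB y Vy) Ay; exact: gh.
Qed.

(* Coordinate permutations and injections: these are the linear changes of
   coordinates along which [class_C_sandwich] applies. *)
Definition coordinate_inj m n (L : {linear 'rV[R]_m -> 'rV[R]_n}) : Prop :=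
  [/\ continuous L, injective L
    & forall i, L (delta_mx 0 i) = 0 \/ exists j, L (delta_mx 0 i) = delta_mx 0 j].

Lemma smooth_on_precomp m n p (L : {linear 'rV[R]_m -> 'rV[R]_n})
    (A : set 'rV[R]_n) (f : 'rV[R]_n -> 'rV[R]_p) :
  coordinate_inj L -> smooth_on A f -> smooth_on (L @^-1` A) (f \o L).
Proof.
move=> [cL _ dL] sf x Ax; have [U [g [oU Ux Cg fg]]] := sf _ Ax.
exists (L @^-1` U), (g \o L); split => //.
- by apply: open_comp => // y _; exact: cL.
- move=> q; apply: (@class_C_sandwich _ _ _ _ _ _ L idfun) => //.
  by move=> y; exact: cvg_id.
- by move=> y Uy Ay; exact: fg.
Qed.

End NearEquality.

(** * Smooth immersions *)

Section SmoothImmersions.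
Context {R : realType}.

Lemma chart_image_open d (M : mfd [set: 'rV[R]_d]) (c : chart M d) (D : set M) :
  atlas c -> open D -> open (c @` (cdom c `&` D)).
Proof.
move=> ac oD; have [_ [W oW cW] cK _ cv] := atlas_chart ac.
rewrite setIT in cW.
have -> : c @` (cdom c `&` D) = W `&` cinv c @^-1` D.
  rewrite -cW; apply/seteqP; split=> [_ [x [cx Dx] <-]|v [[x cx <-]]] /=.
    by rewrite cK //; split => //; exists x.
  by rewrite cK // => Dx; exists x.
move: cv; rewrite cW (continuous_open_subspace _ oW) => cv.
rewrite openE => v [Wv Dv]; apply: filterI; first exact: open_nbhs_nbhs.
by apply: cv; [rewrite inE|exact: open_nbhs_nbhs].
Qed.

Lemma chart_image_nbhs d (M : mfd [set: 'rV[R]_d]) (c : chart M d) (D : set M) x :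
  atlas c -> cdom c x -> nbhs x D -> nbhs (c x) (c @` (cdom c `&` D)).
Proof.
move=> ac cx; rewrite nbhsE => -[V [oV Vx] VD].
apply: (@filterS _ (nbhs (c x)) _ (c @` (cdom c `&` V))).
  by apply: image_subset => y [cy Vy]; split => //; exact: VD.
by apply: open_nbhs_nbhs; split; [exact: chart_image_open|exists x].
Qed.

Lemma near_chart d (M : mfd [set: 'rV[R]_d]) (c : chart M d) (P : M -> Prop) x :
  atlas c -> cdom c x -> (\near x, P x) -> \forall v \near c x, P (cinv c v).
Proof.
move=> ac cx Px; apply: filterS (chart_image_nbhs ac cx Px) => _ [y [cy Py] <-].
by rewrite (chartK (atlas_chart ac)).
Qed.

Definition smooth_immersion d e (K : set 'rV[R]_e) (M : mfd [set: 'rV[R]_d])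
    (N : mfd K) (f : M -> N) : Prop :=
  smooth f /\ immersion f.

(** As the source has no boundary, the chart expression lives on an open set, where it agrees near
    the point with a C^1 extension. The target may be modelled on a half space. *)
Lemma smooth_differentiable d e (K : set 'rV[R]_e) (M : mfd [set: 'rV[R]_d])
    (N : mfd K) (f : M -> N) (c : chart M d) (c' : chart N e) x :
  smooth f -> atlas c -> atlas c' -> cdom c x -> cdom c' (f x) ->
  differentiable (c' \o f \o cinv c) (c x).
Proof.
move=> [cf sf] ac ac' cx c'x.
have Ax : (c @` (cdom c `&` f @^-1` cdom c')) (c x) by exists x.
have [U [g [oU Ux Cg fg]]] := sf c c' ac ac' (c x) Ax.
apply: near_eq_differentiable (class_C1_differentiable oU (Cg 1%N) Ux).
have oA : open (c @` (cdom c `&` f @^-1` cdom c')).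
  apply: chart_image_open => //; apply: open_comp => [y _|]; first exact: cf.
  by have [] := atlas_chart ac'.
have nA := open_nbhs_nbhs (conj oA Ax); have nU := open_nbhs_nbhs (conj oU Ux).
by apply: filterS2 nA nU => v Av Uv; exact: fg.
Qed.

(** Differentiating [g (f x) = x] in charts provides a left inverse of the differential of [f]. *)
Lemma diffeo_smooth_immersion d e (M : mfd [set: 'rV[R]_d]) (N : mfd [set: 'rV[R]_e])
    (f : M -> N) (g : N -> M) :
  smooth f -> smooth g -> cancel f g -> smooth_immersion f.
Proof.
move=> sf sg fK; split => // c c' x ac ac' cx c'x.
have df := smooth_differentiable sf ac ac' cx c'x.
have cgx : cdom c (g (f x)) by rewrite fK.
have dg := smooth_differentiable sg ac' ac c'x cgx.
have [_ _ cK _ _] := atlas_chart ac; have [oc' _ cK' _ _] := atlas_chart ac'.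
set F := c' \o f \o cinv c in df *; set G := c \o g \o cinv c' in dg.
have Fx : F (c x) = c' (f x) by rewrite /F /= cK.
have GF : \forall v \near c x, (G \o F) v = id v.
  have nf : nbhs x (f @^-1` cdom c') by apply: (sf.1 x); exact: open_nbhs_nbhs.
  apply: filterS (chart_image_nbhs ac cx nf) => _ [y [cy c'y] <-].
  by rewrite /G /F /= cK // cK' // fK.
have dG : differentiable G (F (c x)) by rewrite Fx.
have E : 'd G (F (c x)) \o 'd F (c x) = id.
  rewrite -(diff_comp df dG) (near_eq_diff GF); last exact: ex_diff.
  exact: diff_val.
by apply: (@can_inj _ _ _ ('d G (F (c x)))) => v; exact: (congr1 (@^~ v) E).
Qed.

Lemma smooth_id d (H : set 'rV[R]_d) (M : mfd H) : smooth (@id M).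
Proof. by split=> [x|c c' ac ac']; [exact: cvg_id|exact: atlas_smooth]. Qed.

Lemma smooth_immersion_id d (M : mfd [set: 'rV[R]_d]) : smooth_immersion (@id M).
Proof. exact: (diffeo_smooth_immersion (@smooth_id _ _ M) (@smooth_id _ _ M)). Qed.

(* In charts, [f] is the linear map [L]: unlike for a general smooth map,
   precomposing with [f] then requires no chain rule for [class_C]. *)
Definition chartwise d e (L : {linear 'rV[R]_d -> 'rV[R]_e})
    (M : mfd [set: 'rV[R]_d]) (N : mfd [set: 'rV[R]_e]) (f : M -> N) : Prop :=
  continuous f /\ forall (c : chart M d) x, atlas c -> cdom c x ->
    exists c1 : chart N e, [/\ atlas c1, cdom c1 (f x), c1 (f x) = L (c x)
      & \forall v \near c x, f (cinv c v) = cinv c1 (L v)].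

(** Near a point, the chart expression of [g \o f] is a chart expression of [g] composed with the
    linear injection [L]. Smoothness follows from [smooth_on_precomp], and the differential is a
    composite of two injections. *)
Lemma smooth_immersion_precomp d e p (K : set 'rV[R]_p)
    (L : {linear 'rV[R]_d -> 'rV[R]_e}) (M : mfd [set: 'rV[R]_d])
    (N : mfd [set: 'rV[R]_e]) (P : mfd K) (f : M -> N) (g : N -> P) :
  coordinate_inj L -> chartwise L f -> smooth_immersion g ->
  smooth_immersion (g \o f).
Proof.
move=> iL [cf ff] [[cg sg] ig]; have [cL injL _] := iL; split.
  split=> [x|c c' ac ac']; first by apply: continuous_comp; [exact: cf|exact: cg].
  apply: smooth_on_near => _ [x [cx c'x] <-].
  have [c1 [ac1 c1x c1fx nf]] := ff c x ac cx.
  have [_ _ cK _ _] := atlas_chart ac; have [oc1 _ cK1 _ _] := atlas_chart ac1.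
  have nL : \forall v \near c x, (c1 @` cdom c1) (L v).
    apply: cL; rewrite -c1fx -[cdom c1]setIT.
    by apply: chart_image_nbhs => //; exact: filterT.
  exists (fun v => f (cinv c v) = cinv c1 (L v) /\ (c1 @` cdom c1) (L v)).
  exists (L @^-1` (c1 @` (cdom c1 `&` g @^-1` cdom c'))).
  exists ((c' \o g \o cinv c1) \o L); split.
  - exact: filterI.
  - exact/smooth_on_precomp/sg.
  - by exists (f x).
  - move=> v [fyu [u c1u uE]] [y [cy c'y] yv]; subst v.
    rewrite -uE cK // cK1 // in fyu.
    split; last by rewrite /= cK // -uE cK1 // fyu.
    by exists u => //; split => //=; rewrite -fyu.
move=> c c' x ac ac' cx c'x.
have [c1 [ac1 c1x c1fx nf]] := ff c x ac cx.
have sG := smooth_differentiable (conj cg sg) ac1 ac' c1x c'x.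
set G := c' \o g \o cinv c1 in sG.
have E : \forall v \near c x, (c' \o (g \o f) \o cinv c) v = (G \o L) v.
  by apply: filterS nf => v /= ->.
have dL : differentiable L (c x) by exact: linear_differentiable.
have dG : differentiable G (L (c x)) by rewrite -c1fx.
rewrite (near_eq_diff E); last exact: differentiable_comp.
rewrite (diff_comp dL dG) diff_lin //.
apply: inj_comp => //; rewrite -c1fx; exact: ig.
Qed.

(** This serves for maps defined by cases along clopen subsets, which are locally one of finitely
    many known immersions. *)
Lemma smooth_immersion_near d e (K : set 'rV[R]_e) (M : mfd [set: 'rV[R]_d])
    (N : mfd K) (f : M -> N) :
  (forall x : M, exists2 g : M -> N, smooth_immersion g & \forall y \near x, f y = g y) ->
  smooth_immersion f.
Proof.
move=> fg; have cf : continuous f.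
  move=> x; have [g [[cg _] _] fgx] := fg x.
  rewrite /continuous_at (nbhs_singleton fgx).
  have gfx : \forall y \near x, g y = f y by apply: filterS fgx => y ->.
  exact: (cvg_trans (near_eq_cvg gfx) (cg x)).
split; first (split=> // c c' ac ac').
  apply: smooth_on_near => _ [x [cx c'x] <-]; have [g [[cg sg] _] fgx] := fg x.
  have [_ _ cK _ _] := atlas_chart ac.
  exists (fun v => f (cinv c v) = g (cinv c v)).
  exists (c @` (cdom c `&` g @^-1` cdom c')), (c' \o g \o cinv c); split.
  - exact: near_chart fgx.
  - exact: sg.
  - by exists x => //; split => //=; rewrite -(nbhs_singleton fgx).
  - move=> v fgy [y [cy c'y] yv] /=; subst v; rewrite cK // in fgy *; rewrite -fgy.
    by split => //; exists y => //; split => //=; rewrite -fgy.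
move=> c c' x ac ac' cx c'x; have [g [sg ig] fgx] := fg x.
rewrite (nbhs_singleton fgx) in c'x.
have E : \forall v \near c x, (c' \o f \o cinv c) v = (c' \o g \o cinv c) v.
  by apply: filterS (near_chart ac cx fgx) => v /= ->.
by rewrite (near_eq_diff E); [exact: ig|exact: smooth_differentiable].
Qed.

End SmoothImmersions.

(** * Disjoint unions, products, and products with a manifold with boundary *)

Section SumsAndProducts.
Context {R : realType}.

Lemma coordinate_inj_id d : @coordinate_inj R d d idfun.
Proof. by split=> // [x|i]; [exact: cvg_id|right; exists i]. Qed.

Lemma smooth_immersion_copair d e (K : set 'rV[R]_e) (I : finType)
    (M : I -> mfd [set: 'rV[R]_d]) (N : mfd K) (f : dsum_mfd M -> N) :
  (forall i, smooth_immersion (fun x : M i => f (existT _ i x))) ->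
  smooth_immersion f.
Proof.
move=> fi; split; first split.
- case=> i x A /(@proj1 _ _ (fi i).1 x) nA; exact: nA.
- move=> _ c' [i [c [ac ->]]] ac'.
  apply: sub_smooth_on ((fi i).1.2 c c' ac ac') => //.
  move=> v [_ [[x cx <-] c'x] <-]; rewrite /= untag_existT.
  by exists x.
- move=> _ c' _ [i [c [ac ->]]] ac' [x cx <-] c'x /=; rewrite untag_existT.
  exact: (fi i).2.
Qed.

Lemma smooth_immersion_existT d e (K : set 'rV[R]_e) (I : finType)
    (M : mfd [set: 'rV[R]_d]) (N : I -> mfd K) j (f : M -> N j) :
  smooth_immersion f ->
  @smooth_immersion _ _ _ _ M (dsum_mfd N) (fun x => existT _ j (f x)).
Proof.
move=> [[cf sf] imf]; split; first split.
- move=> x; apply: (@continuous_comp _ _ _ f (existT _ j)); first exact: cf.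
  exact: existT_continuous.
- move=> c _ ac [i [c' [ac' ->]]].
  have [ij|ij] := eqVneq i j; last first.
    move=> v [x [_ [y _ yx]] _]; exfalso; move: ij => /eqP; apply.
    exact: (congr1 (@projT1 _ _) yx).
  subst i; apply: sub_smooth_on (sf c c' ac ac').
    by move=> _ [x [cx [y c'y yx]] <-]; exists x => //; split=> //=; rewrite -(existT_inj2 yx).
  by move=> v _ /=; rewrite untag_existT.
- move=> c _ x ac [i [c' [ac' ->]]] cx [y c'y yx].
  have ij : i = j := congr1 (@projT1 _ _) yx.
  subst i; have {}yx := existT_inj2 yx; subst y.
  have -> : dsum_chart c' \o (fun x => existT _ j (f x)) \o cinv c = c' \o f \o cinv c.
    by apply/funext => v /=; rewrite untag_existT.
  exact: imf.
Qed.

Lemma chartwise_existT d (I : finType) (M : I -> mfd [set: 'rV[R]_d]) i :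
  chartwise idfun (existT _ i : M i -> dsum_mfd M).
Proof.
split; first exact: existT_continuous.
move=> c x ac cx; exists (dsum_chart c); split => /=.
- by exists i, c.
- by exists x.
- by rewrite untag_existT.
- by apply: (@nearW _ (nbhs (c x))) => v.
Qed.

Lemma diff_sandwichD (V V1 V2 W1 W2 W : normedModType R)
    (p1 : {linear V -> V1}) (p2 : {linear V -> V2})
    (L1 : {linear W1 -> W}) (L2 : {linear W2 -> W})
    (f : V1 -> W1) (g : V2 -> W2) v :
  continuous p1 -> continuous p2 -> continuous L1 -> continuous L2 ->
  differentiable f (p1 v) -> differentiable g (p2 v) ->
  forall w, 'd (fun u => L1 (f (p1 u)) + L2 (g (p2 u))) v w =
    L1 ('d f (p1 v) (p1 w)) + L2 ('d g (p2 v) (p2 w)).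
Proof.
move=> cp1 cp2 cL1 cL2 df dg w.
have d1 : differentiable p1 v by exact: linear_differentiable.
have d2 : differentiable p2 v by exact: linear_differentiable.
have dL1 x : differentiable L1 x by exact: linear_differentiable.
have dL2 x : differentiable L2 x by exact: linear_differentiable.
have df1 := differentiable_comp d1 df; have dg2 := differentiable_comp d2 dg.
rewrite -[fun u => _]/((L1 \o (f \o p1)) + (L2 \o (g \o p2))).
rewrite diffD; [|exact: differentiable_comp..].
rewrite (diff_comp df1 (dL1 _)) (diff_comp dg2 (dL2 _)) !diff_lin //.
by rewrite (diff_comp d1 df) (diff_comp d2 dg) !diff_lin.
Qed.

Lemma diff_cstD_linear (V W1 W : normedModType R) (L : {linear W1 -> W})
    (f : V -> W1) (a : W) v : continuous L -> differentiable f v ->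
  forall w, 'd (fun u => a + L (f u)) v w = L ('d f v w).
Proof.
move=> cL df w; have dL x : differentiable L x by exact: linear_differentiable.
rewrite -[fun u => _]/(cst a + (L \o f)) diffD//; last exact: differentiable_comp.
by rewrite /= diff_cst add0r (diff_comp df (dL _)) diff_lin.
Qed.

Lemma diff_rV_prod m n m' n' (f : 'rV[R]_m -> 'rV[R]_m')
    (g : 'rV[R]_n -> 'rV[R]_n') v :
  differentiable f (lsubmx v) -> differentiable g (rsubmx v) ->
  'd (rV_prod f g) v = rV_prod ('d f (lsubmx v)) ('d g (rsubmx v)) :> (_ -> _).
Proof.
move=> df dg.
pose Ll : {linear 'rV[R]_m' -> 'rV[R]_(m' + n')} := mulmxr (row_mx 1%:M 0).
pose Lr : {linear 'rV[R]_n' -> 'rV[R]_(m' + n')} := mulmxr (row_mx 0 1%:M).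
have LE x y : Ll x + Lr y = row_mx x y.
  by rewrite /Ll /Lr /= !mul_mx_row !mulmx1 !mulmx0 -row_mxDE.
have -> : rV_prod f g = fun u => Ll (f (lsubmx u)) + Lr (g (rsubmx u)).
  by apply/funext => u; rewrite LE.
apply/funext => w; rewrite /rV_prod -LE.
apply: (diff_sandwichD (L1 := Ll) (L2 := Lr)) => //.
- exact: continuous_lsubmx.
- exact: continuous_rsubmx.
- exact: continuous_mulmxr.
- exact: continuous_mulmxr.
Qed.

Lemma rV_prod_inj m n m' n' (f : 'rV[R]_m -> 'rV[R]_m')
    (g : 'rV[R]_n -> 'rV[R]_n') :
  injective f -> injective g -> injective (rV_prod f g).
Proof.
move=> If Ig u v /eq_row_mx[/If luv /Ig ruv].
by rewrite -[u]hsubmxK -[v]hsubmxK luv ruv.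
Qed.

Lemma prod_chart_smooth_on d e d' e' (H : set 'rV[R]_d) (K : set 'rV[R]_e)
    (H' : set 'rV[R]_d') (K' : set 'rV[R]_e') (M : mfd H) (N : mfd K)
    (M' : mfd H') (N' : mfd K') (f : M -> M') (g : N -> N')
    (c : @chart R M d) (b : @chart R N e)
    (c' : @chart R M' d') (b' : @chart R N' e') :
  smooth_on (c @` (cdom c `&` f @^-1` cdom c')) (c' \o f \o cinv c) ->
  smooth_on (b @` (cdom b `&` g @^-1` cdom b')) (b' \o g \o cinv b) ->
  smooth_on (prod_chart c b @` (cdom (prod_chart c b) `&`
      prod_map f g @^-1` cdom (prod_chart c' b')))
    (prod_chart c' b' \o prod_map f g \o cinv (prod_chart c b)).
Proof.
move=> sf sg; apply: sub_smooth_on (smooth_on_prod sf sg) => //.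
move=> _ [[x y] [[/= cx bY] [c'x b'y]] <-].
by rewrite /rV_setX /= row_mxKl row_mxKr; split; [exists x|exists y].
Qed.

Lemma half_space_setX n m :
  @half_space R (n + m) = rV_setX (@half_space R n) [set: 'rV[R]_m].
Proof.
have v00 (v : 'rV[R]_(n.+1 + m)) : lsubmx v 0 0 = v 0 0.
  by rewrite mxE; congr (v _ _); exact: val_inj.
by apply/seteqP; split=> v; rewrite /half_space /rV_setX /= v00 // => -[].
Qed.

Section HalfSpaceProduct.
Variables (n m : nat) (W : mfd (@half_space R n)) (N : mfd [set: 'rV[R]_m]).

Definition halfprod_atlas : set (chart (W * N)%type (n + m).+1) :=
  [set c | exists (c1 : chart W n.+1) (c2 : chart N m),
    [/\ atlas c1, atlas c2 & c = prod_chart c1 c2]].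

Lemma halfprod_atlas_chart c : halfprod_atlas c -> is_chart (half_space (n := n + m)) c.
Proof.
move=> [c1 [c2 [ac1 ac2 ->]]]; rewrite half_space_setX.
exact: (prod_is_chart (atlas_chart ac1) (atlas_chart ac2)).
Qed.

Lemma halfprod_atlas_cover x : exists2 c, halfprod_atlas c & cdom c x.
Proof.
have [c1 ac1 cx1] := atlas_cover x.1; have [c2 ac2 cx2] := atlas_cover x.2.
by exists (prod_chart c1 c2) => //; exists c1, c2.
Qed.

Lemma halfprod_atlas_smooth c c' : halfprod_atlas c -> halfprod_atlas c' ->
  smooth_on (c @` (cdom c `&` cdom c')) (c' \o cinv c).
Proof.
move=> [c1 [c2 [ac1 ac2 ->]]] [c1' [c2' [ac1' ac2' ->]]].
have H := prod_chart_smooth_on ((@smooth_id _ _ _ W).2 _ _ ac1 ac1')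
  ((@smooth_id _ _ _ N).2 _ _ ac2 ac2').
by apply: sub_smooth_on H => // v [[x y] [[/= ? ?] [? ?]] <-]; exists (x, y).
Qed.

Definition halfprod_mfd : mfd (@half_space R (n + m)).
Proof.
refine (@Mfd R (n + m).+1 _ (W * N)%type halfprod_atlas halfprod_atlas_chart
  halfprod_atlas_cover halfprod_atlas_smooth _ _).
- move=> [x y] [x' y'] xy; congr pair.
    apply: (@mfd_hausdorff _ _ _ W) => A B nA nB.
    have [] := xy (fst @^-1` A) (fst @^-1` B); [exact: cvg_fst|exact: cvg_fst|].
    by move=> z [Az Bz]; exists z.1.
  apply: (@mfd_hausdorff _ _ _ N) => A B nA nB.
  have [] := xy (snd @^-1` A) (snd @^-1` B); [exact: cvg_snd|exact: cvg_snd|].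
  by move=> z [Az Bz]; exists z.2.
- by rewrite -setXTT; apply: compact_setX; exact: mfd_compact.
Defined.

Lemma boundary_halfprod (x : halfprod_mfd) :
  boundary x <-> boundary (x.1 : W).
Proof.
have r00 (u : 'rV[R]_n.+1) (v : 'rV[R]_m) : row_mx u v 0 (0 : 'I_(n + m).+1) = u 0 0.
  by rewrite (_ : 0 = lshift m (0 : 'I_n.+1)) ?row_mxEl//; exact: val_inj.
split=> [[_ [[c1 [c2 [ac1 ac2 ->]]] [/= c1x c2x]]]|[c1 [ac1 c1x]]].
  by rewrite r00 => c10; exists c1.
move=> c10; have [c2 ac2 c2x] := atlas_cover x.2.
by exists (prod_chart c1 c2); split=> //; [exists c1, c2|rewrite /= r00].
Qed.

End HalfSpaceProduct.

Lemma prod_map_continuous (S T S' T' : topologicalType) (f : S -> S') (g : T -> T') :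
  continuous f -> continuous g -> continuous (prod_map f g).
Proof.
move=> cf cg [x y]; apply: cvg_pair => /=.
  apply: (@cvg_comp _ _ _ fst f _ (nbhs x)); [exact: cvg_fst|exact: cf].
apply: (@cvg_comp _ _ _ snd g _ (nbhs y)); [exact: cvg_snd|exact: cg].
Qed.

Lemma halfprod_map_smooth n m n' m' (W : mfd (@half_space R n))
    (N : mfd [set: 'rV[R]_m]) (W' : mfd (@half_space R n'))
    (N' : mfd [set: 'rV[R]_m']) (f : W -> W') (g : N -> N') :
  smooth f -> smooth g ->
  smooth (prod_map f g : halfprod_mfd W N -> halfprod_mfd W' N').
Proof.
move=> [cf sf] [cg sg]; split; first exact: prod_map_continuous.
move=> _ _ [c1 [c2 [ac1 ac2 ->]]] [c1' [c2' [ac1' ac2' ->]]].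
exact: prod_chart_smooth_on (sf _ _ ac1 ac1') (sg _ _ ac2 ac2').
Qed.

Lemma smooth_immersion_prod_map d m n m' (M : mfd [set: 'rV[R]_d])
    (N : mfd [set: 'rV[R]_m]) (W : mfd (@half_space R n))
    (N' : mfd [set: 'rV[R]_m']) (f : M -> W) (g : N -> N') :
  smooth_immersion f -> smooth_immersion g ->
  smooth_immersion (prod_map f g : prod_mfd M N -> halfprod_mfd W N').
Proof.
move=> [sf imf] [sg img]; split; first split.
- exact: prod_map_continuous sf.1 sg.1.
- move=> _ _ [c1 [c2 [ac1 ac2 ->]]] [c1' [c2' [ac1' ac2' ->]]].
  exact: prod_chart_smooth_on (sf.2 _ _ ac1 ac1') (sg.2 _ _ ac2 ac2').
- move=> _ _ [x y] [c1 [c2 [ac1 ac2 ->]]] [c1' [c2' [ac1' ac2' ->]]] [cx cy] [cx' cy'].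
  have dF := smooth_differentiable sf ac1 ac1' cx cx'.
  have dG := smooth_differentiable sg ac2 ac2' cy cy'.
  have I : injective ('d (rV_prod (c1' \o f \o cinv c1) (c2' \o g \o cinv c2))
      (row_mx (c1 x) (c2 y))).
    rewrite diff_rV_prod; rewrite ?row_mxKl ?row_mxKr //.
    by apply: rV_prod_inj; [exact: imf|exact: img].
  exact: I.
Qed.

(** In charts, the slice over [w] is a constant plus a linear injection applied to the chart
    expression of [f], so [class_C_sandwich] gives its smoothness, and its differential is that of
    [f] followed by the injection. *)
Lemma smooth_immersion_pair d m n (M : mfd [set: 'rV[R]_d])
    (N : mfd [set: 'rV[R]_m]) (W : mfd (@half_space R n)) (w : W) (f : M -> N) :
  smooth_immersion f ->
  smooth_immersion ((fun x => (w, f x)) : M -> halfprod_mfd W N).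
Proof.
move=> [[cf sf] imf]; split; first split.
- by move=> x; apply: cvg_pair; [exact: cvg_cst|exact: cf].
- move=> c _ ac [c1 [c2 [ac1 ac2 ->]]] v [x [cx [/= c1w c2x]] xv].
  have Ax : (c @` (cdom c `&` f @^-1` cdom c2)) v by exists x.
  have [U [g [oU Uv Cg fg]]] := sf c c2 ac ac2 v Ax.
  exists U, (fun u => row_mx (c1 w) 0 + mulmxr (row_mx 0 1%:M) (g u)); split => //.
    move=> p; apply: class_CD => //; first exact: class_C_cst.
    have := @class_C_sandwich R p _ _ _ _ idfun
      (mulmxr (row_mx 0 1%:M) : {linear 'rV[R]_m -> 'rV[R]_(n.+1 + m)}) U g.
    apply=> //; last by move=> i; right; exists i.
      by move=> y; exact: cvg_id.
    exact: continuous_mulmxr.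
  move=> u Uu [y [cy [_ c2y]] yu]; rewrite -fg//; last by exists y.
  by rewrite /= mul_mx_row mulmx1 mulmx0 -row_mxDE.
- move=> c _ x ac [c1 [c2 [ac1 ac2 ->]]] cx [/= c1w c2x].
  have dF := smooth_differentiable (conj cf sf) ac ac2 cx c2x.
  set F := c2 \o f \o cinv c in dF.
  pose L : {linear 'rV[R]_m -> 'rV[R]_(n.+1 + m)} := mulmxr (row_mx 0 1%:M).
  have cL : continuous L by exact: continuous_mulmxr.
  have LE y : row_mx (c1 w) 0 + L y = row_mx (c1 w) y.
    by rewrite /L /= mul_mx_row mulmx1 mulmx0 -row_mxDE.
  have I : injective ('d (fun u => row_mx (c1 w) 0 + L (F u)) (c x)).
    move=> u v; rewrite !(diff_cstD_linear _ cL) //.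
    by rewrite /L /= !mul_mx_row !mulmx1 !mulmx0 => /eq_row_mx[_]; exact: imf.
  by have -> : prod_chart c1 c2 \o (fun x => (w, f x)) \o cinv c =
      fun u => row_mx (c1 w) 0 + L (F u) by apply/funext => u; rewrite LE.
Qed.

End SumsAndProducts.

(** * The segment as a manifold with boundary *)

Section SetTypeTopology.
Context {T : topologicalType}.
Implicit Types A : set T.

Lemma nbhs_set_type A (x : A) (U : set A) :
  nbhs x U <-> exists2 V, nbhs (set_val x) V & forall y : A, V (set_val y) -> U y.
Proof.
split=> [[_ [[V oV <-] Vx] VU]|[V nV VU]].
  by exists V; [exact: open_nbhs_nbhs|move=> y Vy; exact: VU].
by apply: filterS VU _; exact: (@initial_continuous A T set_val).
Qed.

Lemma set_val_continuous A : continuous (set_val : A -> T).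
Proof. exact: (@initial_continuous A T set_val). Qed.

Lemma cvg_set_type A (S : Type) (F : set_system S) (f : S -> A) (x : A) :
  Filter F -> set_val \o f @ F --> set_val x -> f @ F --> x.
Proof.
move=> FF fx U /nbhs_set_type[V nV VU].
by apply: (@filterS _ F FF _ _ _ (fx _ nV)) => y; exact: VU.
Qed.

Lemma set_type_hausdorff A : hausdorff_space T -> hausdorff_space A.
Proof.
move=> hT x y xy; apply: val_inj; apply: (hT (set_val x) (set_val y)) => B C nB nC.
have [z [Bz Cz]] := xy _ _ (@set_val_continuous A x _ nB) (@set_val_continuous A y _ nC).
by exists (set_val z).
Qed.

Lemma set_type_compact A : compact A -> compact [set: A].
Proof.
move=> cA F FF _; have [|p [Ap pF]] := cA (set_val @ F) _.
  by apply: (@filterS _ F _ setT) filterT => x _; exact: set_valP.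
exists (SigSub (mem_set Ap)); split=> // B C FB /nbhs_set_type[V nV VC].
have [|_ [[z Bz <-] Vz]] := pF (set_val @` B) V _ nV.
  by apply: (@filterS _ F _ B) FB => z Bz; exists z.
by exists z; split=> //; exact: VC.
Qed.

End SetTypeTopology.

Section Segment.
Context {R : realType}.

Definition segment : set R := `[-1, 1]%classic.

Lemma segmentP (x : R) : segment x <-> `|x| <= 1.
Proof. by rewrite /segment /= in_itv /= ler_norml. Qed.

Lemma segment_sign b (x : R) : segment x -> segment ((-1) ^+ b * x).
Proof. by rewrite !segmentP normrMsign. Qed.

Lemma segment_end_subproof b : ((-1) ^+ b : R) \in segment.
Proof. by apply/mem_set/segmentP; rewrite normr_sign. Qed.

Definition segment_end (b : bool) : segment := SigSub (segment_end_subproof b).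

Definition segment_flip (b : bool) (t : segment) : segment :=
  SigSub (mem_set (segment_sign b (set_valP t))).

Lemma segment_flip_end b s : segment_flip b (segment_end s) = segment_end (b (+) s).
Proof. by apply: val_inj; rewrite /= signr_addb. Qed.

(* The coordinate is the distance to [segment_end s]. *)
Definition segment_chart (s : bool) : @chart R segment 1 :=
  Chart [set t : segment | -1 < (-1) ^+ s * set_val t]
    (fun t => const_mx (1 - (-1) ^+ s * set_val t))
    (fun v => insubd (segment_end false) ((-1) ^+ s * (1 - v 0 0))).

Lemma signrMK (b : bool) (x : R) : (-1) ^+ b * ((-1) ^+ b * x) = x.
Proof. by rewrite mulrA -signr_addb addbb mul1r. Qed.

Lemma segment_chart_image s :
  segment_chart s @` cdom (segment_chart s) =
  [set v : 'rV[R]_1 | v 0 0 < 2] `&` half_space (n := 0).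
Proof.
apply/seteqP; split=> v.
  move=> [t /= ts <-]; rewrite /half_space /= !mxE.
  have /segmentP : segment ((-1) ^+ s * set_val t) by apply/segment_sign/set_valP.
  by rewrite ler_norml => /andP[_ t1]; split; lra.
rewrite /half_space /= => -[v2 v0].
have vs : segment ((-1) ^+ s * (1 - v 0 0)).
  by apply/segment_sign/segmentP; rewrite ler_norml; apply/andP; split; lra.
exists (SigSub (mem_set vs)); rewrite /= set_valE /= signrMK; first lra.
by apply/rowP => i; rewrite !mxE ord1; lra.
Qed.

Lemma segment_cinvE s v : (segment_chart s @` cdom (segment_chart s)) v ->
  set_val (cinv (segment_chart s) v) = (-1) ^+ s * (1 - v 0 0).
Proof.
move=> [t ts <-] /=; rewrite !mxE opprB addrCA subrr addr0 signrMK.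
by rewrite set_valE insubdK//; exact: (valP t).
Qed.

Lemma segment_is_chart s : is_chart (half_space (n := 0)) (segment_chart s).
Proof.
have cs : continuous (fun t : segment => (-1) ^+ s * set_val t : R).
  move=> t; apply: (@continuous_comp _ _ _ set_val (fun x : R => (-1) ^+ s * x)).
    exact: set_val_continuous.
  exact: mulrl_continuous.
have cs1 : continuous (fun t : segment => 1 - (-1) ^+ s * set_val t : R).
  move=> t; apply: (@continuous_comp _ _ _ set_val (fun x : R => 1 - (-1) ^+ s * x)).
    exact: set_val_continuous.
  by apply: cvgB; [exact: cvg_cst|exact: mulrl_continuous].
split.
- by apply: (open_comp (D := [set x : R | -1 < x])) => [t _|]; [exact: cs|exact: open_gt].
- exists [set v : 'rV[R]_1 | v 0 0 < 2]; last exact: segment_chart_image.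
  apply: (open_comp (D := [set x : R | x < 2])) => [v _|]; last exact: open_lt.
  exact: coord_continuous.
- move=> t /= ts; apply: val_inj.
  rewrite mxE opprB addrCA subrr addr0 signrMK insubdK//; exact: (valP t).
- move=> t _; apply: (@cvg_comp _ _ _ (fun t : segment => 1 - (-1) ^+ s * set_val t : R)
    const_mx _ (nbhs (1 - (-1) ^+ s * set_val t))).
    exact: cs1.
  move=> B /nbhs_ballP[e /= e0 eB]; apply/nbhs_ballP; exists e => //= x xe.
  by apply: eB; split=> // i j; rewrite !mxE.
- apply/subspace_continuousP => v iv; apply: cvg_set_type.
  rewrite (segment_cinvE iv).
  move=> B nB.
  have cv : {for v, continuous (fun w : 'rV[R]_1 => (-1) ^+ s * (1 - w 0 0) : R)}.
    apply: (@continuous_comp _ _ _ (fun w : 'rV[R]_1 => w 0 0)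
      (fun x : R => (-1) ^+ s * (1 - x))); first exact: coord_continuous.
    apply: (@continuous_comp _ _ _ (fun x : R => 1 - x)); last exact: mulrl_continuous.
    by apply: cvgB; [exact: cvg_cst|exact: cvg_id].
  apply: (@filterS _ (nbhs v) _ _ _ _ (cv _ nB)) => w Bw iw.
  by rewrite /= [X in B X](segment_cinvE iw).
Qed.

(** In coordinates the map is the identity or the reflection [2 - v], according to the parity of
    [s' + b + s]. With [b = false] these are the transition maps, in general the chart expressions
    of the flips. *)
Lemma segment_smooth_on b s s' (D : set 'rV[R]_1) :
  D `<=` segment_chart s @` cdom (segment_chart s) ->
  smooth_on D (segment_chart s' \o segment_flip b \o cinv (segment_chart s)).
Proof.
move=> Ds.
have E v : D v -> (segment_chart s' \o segment_flip b \o cinv (segment_chart s)) v =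
    (if s' (+) b (+) s then fun v => const_mx 2 - v else id) v.
  move=> Dv; apply/rowP => i; rewrite ord1 mxE.
  rewrite -[LHS]/(1 - (-1) ^+ s' * ((-1) ^+ b * set_val (cinv (segment_chart s) v))).
  rewrite (segment_cinvE (Ds v Dv)) !mulrA -!signr_addb.
  by case: (_ (+) s); rewrite /= ?mxE; ring.
apply: (sub_smooth_on _ E (B := setT)) => //.
case: ifP => _; last exact: smooth_on_id.
move=> v _; exists setT, (fun v => const_mx 2 - v); split => //; first exact: openT.
move=> p; apply: class_CD; [exact: openT|exact: class_C_cst|].
apply: (@class_C_sandwich R p 1 1 1 1 idfun (-%R) setT id) => //.
- by move=> u; exact: cvg_id.
- exact: opp_continuous.
- exact: openT.
- by move=> i; right; exists i.
- exact: class_C_id.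
Qed.

Lemma segment_flip_continuous b : continuous (segment_flip b).
Proof.
move=> t; apply: (@cvg_set_type _ _ _ (nbhs t)).
apply: (@continuous_comp _ _ _ set_val (fun x : R => (-1) ^+ b * x)).
  exact: set_val_continuous.
exact: mulrl_continuous.
Qed.

Definition segment_mfd : mfd (@half_space R 0).
Proof.
refine (@Mfd R 1 _ segment (range segment_chart) _ _ _ _ _).
- by move=> _ [s _ <-]; exact: segment_is_chart.
- move=> t.
  (* With this sign, the condition defining the chart domain reads [-1 < |t|]. *)
  exists (segment_chart (set_val t < 0)); first by exists (set_val t < 0).
  by rewrite /cdom /= -normrEsign (lt_le_trans _ (normr_ge0 _)) ?oppr_lt0.
- move=> _ _ [s _ <-] [s' _ <-].
  apply: sub_smooth_on (@segment_smooth_on false s s' _ (@subset_refl _ _)).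
    by apply: image_subset => t [].
  move=> v _ /=; congr (segment_chart s' _).
  by apply: val_inj; rewrite /= mul1r.
- by apply: set_type_hausdorff; exact: Rhausdorff.
- by apply: set_type_compact; exact: segment_compact.
Defined.

Lemma segment_flip_smooth b : smooth (segment_flip b : segment_mfd -> segment_mfd).
Proof.
split; first exact: segment_flip_continuous.
move=> _ _ [s _ <-] [s' _ <-]; apply: segment_smooth_on.
by apply: image_subset => t [].
Qed.

Lemma boundary_segment (t : segment_mfd) :
  boundary t <-> exists b, t = segment_end b.
Proof.
have c00 s (u : segment) : segment_chart s u 0 0 = 1 - (-1) ^+ s * set_val u.
  by rewrite mxE.
split=> [[_ [[s _ <-]] _]|[b ->]].
  rewrite c00 => /eqP; rewrite subr_eq0 => /eqP E; exists s; apply: val_inj.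
  by have := congr1 (fun x => (-1) ^+ s * x) E; rewrite signrMK mulr1 => /esym.
exists (segment_chart b); split; [by exists b| |]; rewrite ?c00 /= -expr2 sqrr_sign.
  lra.
by rewrite subrr.
Qed.

End Segment.

(** * Bordisms *)

Section EquivariantBounding.
Context {R : realType} {k : nat}.
Local Notation closed_gmfd n := (gmfd k [set: 'rV[R]_n]).

Definition copair (I T : Type) (S : I -> Type) (f : forall i, S i -> T)
  (z : {i & S i}) : T := f (projT1 z) (projT2 z).

Section HalfProductAction.
Variables (n m : nat) (W : gmfd k (@half_space R n)) (N : closed_gmfd m).

Definition halfprod_gmfd : gmfd k (@half_space R (n + m)).
Proof.
refine (@GMfd R k _ _ (halfprod_mfd W N)
  (fun g => prod_map (@act _ _ _ _ W g) (@act _ _ _ _ N g)) _ _ _).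
- by case=> x y; rewrite /prod_map /= !act0.
- by move=> g h [x y]; rewrite /prod_map /= !actD.
- by move=> g; apply: halfprod_map_smooth; exact: act_smooth.
Defined.

End HalfProductAction.

Section SegmentAction.
Variable chi : 'rV['F_2]_k -> bool.
Hypotheses (chi0 : chi 0 = false) (chiD : {morph chi : g h / g + h >-> g (+) h}).

Definition segment_gmfd : gmfd k (@half_space R 0).
Proof.
refine (@GMfd R k _ _ segment_mfd (fun g => segment_flip (chi g)) _ _ _).
- by move=> t; apply: val_inj; rewrite chi0 /= mul1r.
- by move=> g h t; apply: val_inj; rewrite chiD /= signr_addb mulrA.
- by move=> g; exact: segment_flip_smooth.
Defined.

End SegmentAction.

(** Products yield dimensions such as [0 + n], or [n + m] where [m + n] is expected; the equality
    [p = n] absorbs the difference. *)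
Lemma bounds_cast n p (M : closed_gmfd n) (W : gmfd k (@half_space R p)) (f : M -> W) :
  p = n -> smooth_immersion f -> injective f -> range f = @boundary R p W ->
  equivariant f -> bounds M.
Proof.
by move=> pn; move: W f; rewrite pn => W f [sf imf] injf rf ef; exists W, f.
Qed.

(* Both the cylinder on a manifold and the unfolding of a manifold whose pieces
   are exchanged by some element are instances: [B] is identified with the two
   ends of a segment times [N], the group acting on the segment through [chi]. *)
Lemma bounds_segment_prod n (B N : closed_gmfd n) (chi : 'rV['F_2]_k -> bool)
    (eps : B -> bool) (phi : B -> N) :
  chi 0 = false -> {morph chi : g h / g + h >-> g (+) h} ->
  smooth_immersion phi ->
  (forall x : B, \forall y \near x, eps y = eps x) ->
  (forall x y, eps x = eps y -> phi x = phi y -> x = y) ->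
  (forall b y, exists2 x, eps x = b & phi x = y) ->
  (forall g x, eps (act g x) = chi g (+) eps x) -> equivariant phi ->
  bounds B.
Proof.
move=> chi0 chiD sphi ceps injphi surjphi eeps ephi.
pose W := halfprod_gmfd (segment_gmfd chi0 chiD) N.
apply: (@bounds_cast n (0 + n) B W (fun x => (segment_end (eps x), phi x))) => //.
(* As [eps] is locally constant, the map is near [x] a slice over one end of the segment. *)
- apply: smooth_immersion_near => x.
  exists (fun y => (segment_end (eps x) : segment_gmfd chi0 chiD, phi y)).
    exact: smooth_immersion_pair.
  by apply: filterS (ceps x) => y ->.
- by move=> x y [exy pxy]; apply: injphi => //; exact: signr_inj exy.
- apply/seteqP; split=> [_ [x _ <-]|[t y]].
    apply/boundary_halfprod/boundary_segment; by exists (eps x).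
  move=> /boundary_halfprod/boundary_segment[b /= ->].
  by have [x <- <-] := surjphi b y; exists x.
- by move=> g x; rewrite eeps ephi /= /prod_map /= segment_flip_end.
Qed.

Definition copair2 n (M N : @cgmfd R k n) (T : Type) (f : M -> T) (g : N -> T) :
    disjoint_union M N -> T :=
  copair (fun b => if b return (if b then M else N : cgmfd k n) -> T then f else g).

Definition inj1 n (M N : @cgmfd R k n) : M -> disjoint_union M N :=
  existT (fun b : bool => (if b then M else N : cgmfd k n) : Type) true.

Definition inj2 n (M N : @cgmfd R k n) : N -> disjoint_union M N :=
  existT (fun b : bool => (if b then M else N : cgmfd k n) : Type) false.

Definition from_empty n (T : Type) (x : empty_cgmfd R k n) : T :=
  match projT1 x with end.

Lemma smooth_immersion_copair2 n p (K : set 'rV[R]_p) (M N : @cgmfd R k n)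
    (P : mfd K) (f : M -> P) (g : N -> P) :
  smooth_immersion f -> smooth_immersion g ->
  smooth_immersion (copair2 f g : disjoint_union M N -> P).
Proof. by move=> sf sg; apply: smooth_immersion_copair => -[]. Qed.

Lemma smooth_immersion_inj1 n (M N : @cgmfd R k n) :
  smooth_immersion (@inj1 n M N).
Proof.
exact: (@smooth_immersion_existT R n n setT bool M
  (fun b : bool => (if b then M else N : cgmfd k n)) true id (smooth_immersion_id _)).
Qed.

Lemma smooth_immersion_inj2 n (M N : @cgmfd R k n) :
  smooth_immersion (@inj2 n M N).
Proof.
exact: (@smooth_immersion_existT R n n setT bool N
  (fun b : bool => (if b then M else N : cgmfd k n)) false id (smooth_immersion_id _)).
Qed.

Lemma smooth_immersion_from_empty n p (K : set 'rV[R]_p) (P : mfd K) :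
  smooth_immersion (@from_empty n P : empty_cgmfd R k n -> P).
Proof. by apply: smooth_immersion_copair => -[]. Qed.

(** The bordism is the cylinder on [N], with [M] identified with one of its ends through [f]. The
    group fixes the segment pointwise, whence the trivial [chi]. *)
Lemma bordant_diffeo n (M N : @cgmfd R k n) (f : M -> N) :
  smooth_immersion f -> injective f -> (forall y, exists x, f x = y) ->
  equivariant f -> bordant M N.
Proof.
move=> sf injf surjf ef.
apply: (@bounds_segment_prod n (disjoint_union M N) N (fun=> false)
  (fun z => projT1 z) (copair2 f id)) => //.
- apply: smooth_immersion_copair2 => //; exact: smooth_immersion_id.
- by move=> [b x]; apply: nearW.
- move=> [[] x] [[] y] //= _; rewrite /copair2 /copair /=; first by move/injf ->.
  by move=> ->.
- move=> [] y; last by exists (inj2 _ y).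
  by have [x xy] := surjf y; exists (inj1 _ x).
- by move=> g [[] x] //=; exact: ef.
Qed.

Lemma bclass_diffeo n (M N : @cgmfd R k n) (f : M -> N) :
  smooth_immersion f -> injective f -> (forall y, exists x, f x = y) ->
  equivariant f -> bclass M = bclass N.
Proof.
by move=> *; apply/eq_bclassP/Relation_Operators.rst_step/bordant_diffeo; eassumption.
Qed.

Lemma bounds_bclass0 n (M : @cgmfd R k n) : bounds M -> bclass M = bzero R k n.
Proof.
move=> [W [f [sf imf injf rf ef]]].
apply/eq_bclassP/Relation_Operators.rst_step.
apply: (@bounds_cast n n _ W (copair2 f (@from_empty n W))) => //.
- by apply: smooth_immersion_copair2 => //; exact: smooth_immersion_from_empty.
- move=> [[] x] [[] y]; [|by case: y => -[]|by case: x => -[]..].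
  by rewrite /copair2 /copair /= => /injf ->.
- rewrite -rf; apply/seteqP; split=> [_ [[[] x] _ <-]|_ [x _ <-]].
  + by exists x.
  + by case: x => -[].
  + by exists (inj1 _ x).
- by move=> g [[] x]; [exact: ef|case: x => -[]].
Qed.

Lemma boundary_dsum n (I : finType) (W : I -> mfd (@half_space R n)) i (w : W i) :
  @boundary R n (dsum_mfd W) (existT _ i w) <-> boundary w.
Proof.
split=> [[_ [[j [c [ac ->]]] [u cu uw]]]|[c [ac cw c0]]].
  have ij : j = i := congr1 (@projT1 _ _) uw.
  subst j; have {}uw := existT_inj2 uw; subst u.
  by rewrite /= untag_existT => c0; exists c.
by exists (dsum_chart c); split; [exists i, c|exists w|rewrite /= untag_existT].
Qed.

Lemma smooth_immersion_dsum_part n p (K : set 'rV[R]_p) (I : finType)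
    (M : I -> mfd [set: 'rV[R]_n]) (P : mfd K) (f : dsum_mfd M -> P) i :
  smooth_immersion f -> smooth_immersion (fun x : M i => f (existT _ i x)).
Proof.
exact: smooth_immersion_precomp (coordinate_inj_id _) (chartwise_existT M i).
Qed.

Lemma bclass_disjoint_union_empty n (M : @cgmfd R k n) :
  bclass (disjoint_union M (empty_cgmfd R k n)) = bclass M.
Proof.
apply: (@bclass_diffeo n _ M (copair2 id (@from_empty n M))).
- apply: smooth_immersion_copair2; first exact: smooth_immersion_id.
  exact: smooth_immersion_from_empty.
- move=> [[] x] [[] y]; [|by case: y => -[]|by case: x => -[]..].
  by rewrite /copair2 /copair /= => ->.
- by move=> x; exists (inj1 _ x).
- by move=> g [[] x]; [|case: x => -[]].
Qed.

Lemma bclass_disjoint_unionC n (M N : @cgmfd R k n) :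
  bclass (disjoint_union M N) = bclass (disjoint_union N M).
Proof.
apply: (@bclass_diffeo n _ _ (copair2 (@inj2 n N M) (@inj1 n N M))).
- apply: smooth_immersion_copair2.
    exact: smooth_immersion_inj2.
  exact: smooth_immersion_inj1.
- move=> [[] x] [[] y]; rewrite /copair2 /copair /= => E.
  + by rewrite (existT_inj2 E).
  + by have := congr1 (@projT1 _ _) E.
  + by have := congr1 (@projT1 _ _) E.
  + by rewrite (existT_inj2 E).
- by move=> [[] x]; [exists (inj2 _ x)|exists (inj1 _ x)].
- by move=> g [[] x].
Qed.

Lemma segment_end_inj : injective (@segment_end R).
Proof. by move=> b b' /(congr1 val) /=; exact: signr_inj. Qed.

Definition cylinder n (N : closed_gmfd n) : gmfd k (@half_space R n) :=
  halfprod_gmfd (@segment_gmfd (fun=> false) erefl (fun _ _ => erefl)) N.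

Lemma smooth_immersion_cylinder_end n (N : closed_gmfd n) b :
  smooth_immersion ((fun x => (segment_end b, x)) : N -> cylinder N).
Proof. exact: smooth_immersion_pair (smooth_immersion_id _). Qed.

(** The bordism is the sum of [W] and the cylinder on [N]. Its boundary consists of [M], [M'] and
    two copies of [N], one for each side. *)
Lemma bordant_disjoint_union n (M M' N : @cgmfd R k n) :
  bordant M M' -> bordant (disjoint_union M N) (disjoint_union M' N).
Proof.
move=> [W [f [sf imf injf rf ef]]].
pose WW b := if b then W else cylinder N.
pose inW (w : W) : dsum_gmfd WW := existT (fun b => WW b : Type) true w.
pose inC (w : cylinder N) : dsum_gmfd WW := existT (fun b => WW b : Type) false w.
have sW (P : closed_gmfd n) (h : P -> W) :
    smooth_immersion h -> smooth_immersion (inW \o h).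
  exact: (@smooth_immersion_existT R n n.+1 _ bool P (fun b => WW b) true h).
have sC b : smooth_immersion (inC \o (fun x : N => (segment_end b, x))).
  apply: (@smooth_immersion_existT R n n.+1 _ bool N (fun b => WW b) false).
  exact: smooth_immersion_cylinder_end.
have sM b : smooth_immersion (fun x : (if b then M else M' : cgmfd k n) => f (existT _ b x)).
  exact: (smooth_immersion_dsum_part b (conj sf imf)).
pose F : disjoint_union (disjoint_union M N) (disjoint_union M' N) -> dsum_gmfd WW :=
  copair2 (copair2 (inW \o (f \o @inj1 _ M M')) (inC \o (fun x : N => (segment_end true, x))))
    (copair2 (inW \o (f \o @inj2 _ M M')) (inC \o (fun x : N => (segment_end false, x)))).
apply: (@bounds_cast n n _ (dsum_gmfd WW) F) => //.
- apply: smooth_immersion_copair2; apply: smooth_immersion_copair2 => //; apply: sW.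
    exact: (sM true).
  exact: (sM false).
- move=> [[] [[] x]] [[] [[] y]]; rewrite /F /copair2 /copair /= => E;
    try (by have := congr1 (@projT1 _ _) E);
    have {}E := existT_inj2 E.
  + by rewrite (existT_inj2 (injf _ _ E)).
  + by have := congr1 (@projT1 _ _) (injf _ _ E).
  + by have -> : x = y := congr1 snd E.
  + by have := segment_end_inj (congr1 fst E).
  + by have := congr1 (@projT1 _ _) (injf _ _ E).
  + by rewrite (existT_inj2 (injf _ _ E)).
  + by have := segment_end_inj (congr1 fst E).
  + by have -> : x = y := congr1 snd E.
- apply/seteqP; split.
    move=> _ [[[] [[] x]] _ <-]; apply/(@boundary_dsum n bool (fun b => WW b)).
    + by rewrite /= -rf; exists (inj1 _ x).
    + by apply/boundary_halfprod/boundary_segment; exists true.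
    + by rewrite /= -rf; exists (inj2 _ x).
    + by apply/boundary_halfprod/boundary_segment; exists false.
  move=> [[] w] /(@boundary_dsum n bool (fun b => WW b)) /=.
    by rewrite -rf => -[[[] x] _ <-]; [exists (inj1 _ (inj1 _ x))|exists (inj2 _ (inj1 _ x))].
  case: w => t y /boundary_halfprod/boundary_segment[b /= ->].
  by case: b; [exists (inj1 _ (inj2 _ y))|exists (inj2 _ (inj2 _ y))].
- move=> g [[] [[] x]]; rewrite /F /copair2 /copair /=.
  + by congr existT; exact: (ef g (inj1 _ x)).
  + by congr existT; rewrite /= /prod_map /= segment_flip_end.
  + by congr existT; exact: (ef g (inj2 _ x)).
  + by congr existT; rewrite /= /prod_map /= segment_flip_end.
Qed.

(** Since [bordism_eq] is a generated equivalence, an operation descends to classes as soon as it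
    respects single bordisms. *)
Lemma bordism_eq_bclass n m (F : @cgmfd R k n -> @cgmfd R k m) :
  (forall M N, bordant M N -> bclass (F M) = bclass (F N)) ->
  forall M N, bordism_eq M N -> bclass (F M) = bclass (F N).
Proof.
by move=> HF M N; elim=> [? ? /HF|?|? ? _ ->|? ? ? _ -> _ ->].
Qed.

End EquivariantBounding.

(** * Addition and multiplication computed on arbitrary representatives *)

Section BordismOperations.
Context {R : realType} {k : nat}.

Lemma bclass_brepr n (M : @cgmfd R k n) : bordism_eq (brepr (bclass M)) M.
Proof. by apply/eq_bclassP; rewrite breprK. Qed.

Lemma badd_bclass n (M N : @cgmfd R k n) :
  badd (bclass M) (bclass N) = bclass (disjoint_union M N).
Proof.
have cong (A B C : @cgmfd R k n) : bordism_eq A B ->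
    bclass (disjoint_union A C) = bclass (disjoint_union B C).
  apply: (@bordism_eq_bclass R k n n (fun A => disjoint_union A C)) => {}A {}B AB.
  exact/eq_bclassP/Relation_Operators.rst_step/bordant_disjoint_union.
rewrite /badd (cong _ M _ (bclass_brepr M)) bclass_disjoint_unionC.
by rewrite (cong _ N _ (bclass_brepr N)) bclass_disjoint_unionC.
Qed.

Lemma baddx0 n (x : bordism_group R k n) : badd x (bzero R k n) = x.
Proof. by rewrite -[x]breprK badd_bclass bclass_disjoint_union_empty. Qed.

Lemma badd0x n (x : bordism_group R k n) : badd (bzero R k n) x = x.
Proof.
by rewrite -[x]breprK badd_bclass bclass_disjoint_unionC bclass_disjoint_union_empty.
Qed.

Definition swap_mx m n : {linear 'rV[R]_(m + n) -> 'rV[R]_(n + m)} :=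
  mulmxr (block_mx 0 1%:M 1%:M 0).

Lemma swap_mxE m n (v : 'rV[R]_(m + n)) :
  swap_mx m n v = row_mx (rsubmx v) (lsubmx v).
Proof.
rewrite /swap_mx /= -[v in LHS]hsubmxK mul_row_block.
by rewrite !mulmx0 !mulmx1 addr0 add0r.
Qed.

Lemma coordinate_inj_swap m n : coordinate_inj (swap_mx m n).
Proof.
split; first exact: continuous_mulmxr.
  move=> u v; rewrite !swap_mxE => /eq_row_mx[ru lu].
  by rewrite -[u]hsubmxK -[v]hsubmxK ru lu.
move=> i; right; rewrite swap_mxE -(splitK i); case: (fintype.split i) => {}i /=.
  exists (rshift n i); apply/rowP => j; rewrite -(splitK j).
  case: (fintype.split j) => {}j /=.
    by rewrite row_mxEl !mxE eq_rlshift eq_lrshift.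
  by rewrite row_mxEr !mxE (inj_eq (@rshift_inj _ _)) (inj_eq (@lshift_inj _ _)).
exists (lshift m i); apply/rowP => j; rewrite -(splitK j).
case: (fintype.split j) => {}j /=.
  by rewrite row_mxEl !mxE (inj_eq (@rshift_inj _ _)) (inj_eq (@lshift_inj _ _)).
by rewrite row_mxEr !mxE eq_rlshift eq_lrshift.
Qed.

Lemma chartwise_swap m n (M : mfd [set: 'rV[R]_m]) (N : mfd [set: 'rV[R]_n]) :
  chartwise (swap_mx m n) ((fun z => (z.2, z.1)) : prod_mfd M N -> prod_mfd N M).
Proof.
split.
  by case=> x y; apply: cvg_pair; [exact: cvg_snd|exact: cvg_fst].
move=> _ [x y] [c [c' [ac ac' ->]]] [cx c'y]; exists (prod_chart c' c); split.
- by exists c', c.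
- by [].
- by rewrite swap_mxE /= row_mxKl row_mxKr.
- by apply: (@nearW _ (nbhs (prod_chart c c' (x, y)))) => v; rewrite swap_mxE /= row_mxKl row_mxKr.
Qed.

Lemma smooth_immersion_swap d m p (M : mfd [set: 'rV[R]_d]) (N : mfd [set: 'rV[R]_m])
    (K : set 'rV[R]_p) (P : mfd K) (f : prod_mfd N M -> P) :
  smooth_immersion f -> smooth_immersion (fun z : prod_mfd M N => f (z.2, z.1)).
Proof. exact: smooth_immersion_precomp (coordinate_inj_swap _ _) (chartwise_swap M N). Qed.

(** The product of the bordism [W] with the closed manifold [N] has as boundary that of [W] times
    [N]. *)
Lemma bordant_cprodl m n (M M' : @cgmfd R k m) (N : @cgmfd R k n) :
  bordant M M' -> bordant (cprod M N) (cprod M' N).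
Proof.
move=> [W [f [sf imf injf rf ef]]].
pose F : disjoint_union (cprod M N) (cprod M' N) -> halfprod_gmfd W N :=
  copair2 (prod_map (f \o @inj1 R k m M M') id : cprod M N -> _)
    (prod_map (f \o @inj2 R k m M M') id : cprod M' N -> _).
apply: (@bounds_cast R k (m + n) (m + n) _ (halfprod_gmfd W N) F) => //.
- apply: smooth_immersion_copair2; apply: smooth_immersion_prod_map;
    try exact: smooth_immersion_id.
    exact: (smooth_immersion_dsum_part true (conj sf imf)).
  exact: (smooth_immersion_dsum_part false (conj sf imf)).
- move=> [[] [x y]] [[] [x' y']]; rewrite /F /copair2 /copair /= => E;
    have yy' : y = y' := congr1 snd E; have {}E := injf _ _ (congr1 fst E).
  + by have -> : x = x' := existT_inj2 E; rewrite yy'.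
  + by have := congr1 (@projT1 _ _) E.
  + by have := congr1 (@projT1 _ _) E.
  + by have -> : x = x' := existT_inj2 E; rewrite yy'.
- apply/seteqP; split.
    by move=> _ [[[] [x y]] _ <-]; apply/boundary_halfprod; rewrite /= -rf;
      [exists (inj1 _ x)|exists (inj2 _ x)].
  move=> [w y] /boundary_halfprod /=; rewrite -rf => -[[[] x] _ <-].
    by exists (inj1 _ ((x, y) : cprod M N)).
  by exists (inj2 _ ((x, y) : cprod M' N)).
- move=> g [[] [x y]]; rewrite /F /copair2 /copair /=.
    by congr pair; exact: (ef g (inj1 _ x)).
  by congr pair; exact: (ef g (inj2 _ x)).
Qed.

(* The coordinate vanishing on the boundary has to come first, so a manifold [W]
   bounding the second factors is used through [W * M], not [M * W]. *)
Lemma bordant_cprodr m n (M : @cgmfd R k m) (N N' : @cgmfd R k n) :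
  bordant N N' -> bordant (cprod M N) (cprod M N').
Proof.
move=> [W [f [sf imf injf rf ef]]].
pose F : disjoint_union (cprod M N) (cprod M N') -> halfprod_gmfd W M :=
  copair2 (fun z : cprod M N => ((f \o @inj1 R k n N N') z.2, z.1))
    (fun z : cprod M N' => ((f \o @inj2 R k n N N') z.2, z.1)).
apply: (@bounds_cast R k (m + n) (n + m) _ (halfprod_gmfd W M) F) => //.
- by rewrite addnC.
- apply: smooth_immersion_copair2.
    apply: (@smooth_immersion_swap _ _ _ M N _ (halfprod_mfd W M)
      (prod_map (f \o @inj1 R k n N N') id)).
    apply: smooth_immersion_prod_map; last exact: smooth_immersion_id.
    exact: (smooth_immersion_dsum_part true (conj sf imf)).
  apply: (@smooth_immersion_swap _ _ _ M N' _ (halfprod_mfd W M)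
      (prod_map (f \o @inj2 R k n N N') id)).
  apply: smooth_immersion_prod_map; last exact: smooth_immersion_id.
  exact: (smooth_immersion_dsum_part false (conj sf imf)).
- move=> [[] [y x]] [[] [y' x']]; rewrite /F /copair2 /copair /= => E;
    have yy' : y = y' := congr1 snd E; have {}E := injf _ _ (congr1 fst E).
  + by have -> : x = x' := existT_inj2 E; rewrite yy'.
  + by have := congr1 (@projT1 _ _) E.
  + by have := congr1 (@projT1 _ _) E.
  + by have -> : x = x' := existT_inj2 E; rewrite yy'.
- apply/seteqP; split.
    by move=> _ [[[] [y x]] _ <-]; apply/boundary_halfprod; rewrite /= -rf;
      [exists (inj1 _ x)|exists (inj2 _ x)].
  move=> [w y] /boundary_halfprod /=; rewrite -rf => -[[[] x] _ <-].
    by exists (inj1 _ ((y, x) : cprod M N)).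
  by exists (inj2 _ ((y, x) : cprod M N')).
- move=> g [[] [y x]]; rewrite /F /copair2 /copair /=.
    by congr pair; exact: (ef g (inj1 _ x)).
  by congr pair; exact: (ef g (inj2 _ x)).
Qed.

Lemma bmul_bclass m n (M : @cgmfd R k m) (N : @cgmfd R k n) :
  bmul (bclass M) (bclass N) = bclass (cprod M N).
Proof.
rewrite /bmul.
rewrite (@bordism_eq_bclass R k m (m + n) (fun A => cprod A _) _ _ _ (bclass_brepr M)).
  apply: (@bordism_eq_bclass R k n (m + n) (fun A => cprod M A) _ _ _ (bclass_brepr N)).
  by move=> A B AB; exact/eq_bclassP/Relation_Operators.rst_step/bordant_cprodr.
by move=> A B AB; exact/eq_bclassP/Relation_Operators.rst_step/bordant_cprodl.
Qed.

End BordismOperations.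

(** * Pulling actions back along surjections *)

Section Pullback.
Context {R : realType} {k l : nat}.
Variable phi : 'M['F_2]_(k, l).

Definition pullback_gmfd d (H : set 'rV[R]_d) (M : gmfd l H) : gmfd k H.
Proof.
refine (@GMfd R k d H M (fun g => @act _ _ _ _ M (g *m phi)) _ _ _).
- by move=> x; rewrite mul0mx act0.
- by move=> g h x; rewrite mulmxDl actD.
- by move=> g; exact: act_smooth.
Defined.

Hypothesis phi_full : row_full phi.

Definition pullback n (M : @cgmfd R l n) : @cgmfd R k n.
Proof.
refine (@CGMfd R k n (pullback_gmfd M) _).
(* By surjectivity every [h] has the form [g *m phi], so pulling back creates no new fixed points
   and they remain isolated. *)
have fixE x : @fixpoints R k n _ (pullback_gmfd M) x -> @fixpoints R l n _ M x.
  move=> fx h; rewrite -[h](@mulmxKpV _ _ _ _ _ phi) ?submx_full//; exact: fx.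
move=> x fx; apply: filterS (cgmfd_isolated (fixE x fx)) => y yx fy.
exact/yx/fixE.
Defined.

Lemma bordant_pullback n (M N : @cgmfd R l n) :
  bordant M N -> bordant (pullback M) (pullback N).
Proof.
move=> [W [f [sf imf injf rf ef]]].
apply: (@bounds_cast R k n n (disjoint_union (pullback M) (pullback N)) (pullback_gmfd W)
  (@copair2 R k n (pullback M) (pullback N) W (f \o @inj1 R l n M N)
    (f \o @inj2 R l n M N))) => //.
- apply: smooth_immersion_copair2.
    exact: (smooth_immersion_dsum_part true (conj sf imf)).
  exact: (smooth_immersion_dsum_part false (conj sf imf)).
- move=> [[] x] [[] y]; rewrite /copair2 /copair /= => /injf E.
  + by have -> : x = y := existT_inj2 E.
  + by have := congr1 (@projT1 _ _) E.
  + by have := congr1 (@projT1 _ _) E.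
  + by have -> : x = y := existT_inj2 E.
- rewrite -[RHS]rf; apply/seteqP; split=> [_ [[[] x] _ <-]|_ [[[] x] _ <-]].
  + by exists (@inj1 R l n M N x).
  + by exists (@inj2 R l n M N x).
  + by exists (@inj1 R k n (pullback M) (pullback N) x).
  + by exists (@inj2 R k n (pullback M) (pullback N) x).
- by move=> g [[] x]; [exact: (ef _ (@inj1 R l n M N x))|exact: (ef _ (@inj2 R l n M N x))].
Qed.

Definition bpull n (x : bordism_group R l n) : bordism_group R k n :=
  bclass (pullback (brepr x)).

Lemma bpull_bclass n (M : @cgmfd R l n) : bpull (bclass M) = bclass (pullback M).
Proof.
apply/eq_bclassP; move: (brepr _) (bclass_brepr M) => M'; elim=> [A B AB|A|A B _|A B C _ AB _ BC].
- exact/Relation_Operators.rst_step/bordant_pullback.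
- exact: Relation_Operators.rst_refl.
- exact: Relation_Operators.rst_sym.
- exact: Relation_Operators.rst_trans AB BC.
Qed.

Lemma bpull_bzero n : bpull (bzero R l n) = bzero R k n.
Proof.
rewrite bpull_bclass; symmetry.
apply: (@bclass_diffeo R k n (empty_cgmfd R k n) (pullback (empty_cgmfd R l n))
  (@from_empty R k n _)).
- exact: smooth_immersion_from_empty.
- by case=> -[].
- by case=> -[].
- by move=> g [[]].
Qed.

Lemma bpull_badd n : {morph (@bpull n) : x y / badd x y}.
Proof.
move=> x y; rewrite -[x]breprK -[y]breprK badd_bclass !bpull_bclass badd_bclass.
move: (brepr x) (brepr y) => M N; symmetry.
apply: (@bclass_diffeo R k n _ (pullback (disjoint_union M N))
  (@copair2 R k n (pullback M) (pullback N) (disjoint_union M N)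
    (@inj1 R l n M N) (@inj2 R l n M N))).
- apply: smooth_immersion_copair2.
    exact: (@smooth_immersion_inj1 R l n M N).
  exact: (@smooth_immersion_inj2 R l n M N).
- move=> [[] u] [[] v]; rewrite /copair2 /copair /= => E.
  + by have -> : u = v := existT_inj2 E.
  + by have := congr1 (@projT1 _ _) E.
  + by have := congr1 (@projT1 _ _) E.
  + by have -> : u = v := existT_inj2 E.
- move=> [[] u].
    by exists (@inj1 R k n (pullback M) (pullback N) u).
  by exists (@inj2 R k n (pullback M) (pullback N) u).
- by move=> g [[] u].
Qed.

Lemma bpull_bmul m n (x : bordism_group R l m) (y : bordism_group R l n) :
  bpull (bmul x y) = bmul (bpull x) (bpull y).
Proof.
rewrite -[x]breprK -[y]breprK bmul_bclass !bpull_bclass bmul_bclass.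
move: (brepr x) (brepr y) => M N.
apply: (@bclass_diffeo R k (m + n) (pullback (cprod M N))
  (cprod (pullback M) (pullback N)) id) => //; last by move=> z; exists z.
exact: (@smooth_immersion_id R _ (prod_mfd M N)).
Qed.

Lemma bpull_bone : bpull (bone R l) = bone R k.
Proof.
rewrite bpull_bclass.
apply: (@bclass_diffeo R k 0 (pullback (@Defs.cpoint R l)) (@Defs.cpoint R k) id) => //.
  exact: (@smooth_immersion_id R _ point_mfd).
by move=> z; exists z.
Qed.

Definition fpull (x : bfamily R l) : bfamily R k := fun n => bpull (x n).

Lemma fpull_fzero : fpull (fzero R l) = fzero R k.
Proof. by apply: functional_extensionality_dep => n; exact: bpull_bzero. Qed.

Lemma fpull_fone : fpull (fone R l) = fone R k.
Proof.
by apply: functional_extensionality_dep => -[|n]; [exact: bpull_bone|exact: bpull_bzero].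
Qed.

Lemma fpull_fadd x y : fpull (fadd x y) = fadd (fpull x) (fpull y).
Proof. by apply: functional_extensionality_dep => n; exact: bpull_badd. Qed.

Lemma bpull_cast m n (e : m = n) (x : bordism_group R l m) :
  bpull (ecast j (bordism_group R l j) e x) = ecast j (bordism_group R k j) e (bpull x).
Proof. by case: _ / e. Qed.

Lemma fpull_fmul x y : fpull (fmul x y) = fmul (fpull x) (fpull y).
Proof.
apply: functional_extensionality_dep => n; rewrite /fpull /fmul.
rewrite (big_morph (@bpull n) (@bpull_badd n) (bpull_bzero n)).
by apply: eq_bigr => i _; rewrite bpull_cast bpull_bmul.
Qed.

Lemma generated_fpull r (s : 'I_r -> bfamily R l) r' (s' : 'I_r' -> bfamily R k) x :
  (forall i, generated s' (fpull (s i))) -> generated s x -> generated s' (fpull x).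
Proof.
move=> ss'; elim=> [i| | |{}x y _ IHx _ IHy|{}x y _ IHx _ IHy].
- exact: ss'.
- rewrite fpull_fzero; exact: generated_zero.
- rewrite fpull_fone; exact: generated_one.
- rewrite fpull_fadd; exact: generated_add.
- rewrite fpull_fmul; exact: generated_mul.
Qed.

End Pullback.

(** * Subgroups over the field with two elements and effective quotients *)

Section Kernels.

(** The only scalars being 0 and 1, a subset containing 0 and closed under addition is a linear
    subspace, hence the row space of a matrix. *)
Lemma F2_subspace k (K : pred 'rV['F_2]_k) :
  K 0 -> (forall g h, K g -> K h -> K (g + h)) ->
  exists A : 'M['F_2]_k, forall g, K g = (g <= A)%MS.
Proof.
move=> K0 KD; exists (\sum_(h | K h) <<h>>)%MS => g; apply/idP/idP => [Kg|].
  by apply: (sumsmx_sup g) => //; rewrite genmxE.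
move=> /sub_sumsmxP[u ->]; elim/big_ind: _ => // h Kh.
have /sub_rVP[a ->] : (u h *m <<h>> <= h)%MS.
  by apply: submx_trans (submxMl _ _) _; rewrite genmxE.
case: a => [[|[|//]] a2] /=.
  by rewrite (_ : Ordinal a2 = 0) ?scale0r//; exact: val_inj.
by rewrite (_ : Ordinal a2 = 1) ?scale1r//; exact: val_inj.
Qed.

(** A subspace is cut out by the columns of its cokernel matrix, so some column does not vanish on a
    vector outside of it; a nonzero element of ['F_2] is 1. The kernel of [u] is an index two
    subgroup that contains [K] but not [t]. *)
Lemma F2_separation k (K : pred 'rV['F_2]_k) t :
  K 0 -> (forall g h, K g -> K h -> K (g + h)) -> ~~ K t ->
  exists u : 'cV['F_2]_k, (forall g, K g -> g *m u = 0) /\ (t *m u) 0 0 = 1.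
Proof.
move=> K0 KD Kt; have [A KA] := F2_subspace K0 KD.
move: Kt; rewrite KA submxE => /eqP/rowP tA.
have [j tj] : exists j, (t *m cokermx A) 0 j != 0.
  by apply/existsP; rewrite -negb_forall; apply: contra_notN tA => /forallP tA j;
    rewrite (eqP (tA j)) mxE.
exists (col j (cokermx A)); split=> [g|].
  rewrite KA submxE => /eqP gA; by rewrite colE mulmxA gA mul0mx.
rewrite colE mulmxA -colE mxE; case: (_ 0 j) tj => [[|[|//]] a2] // _; exact: val_inj.
Qed.

Context {R : realType}.

(** The kernel of the action is a row space [A], that is the kernel of [cokermx A]. The factor
    [col_base] of this matrix is a surjection [phi] with the same kernel. The quotient [N] has the
    same underlying manifold as [M], with the smaller group acting through a section [psi] of [phi];
    [actK] says that pulling [N] back along [phi] restores the original action. *)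
Lemma effective_quotient k n (M : @cgmfd R k n) :
  exists l (phi : 'M['F_2]_(k, l)) (phi_full : row_full phi) (N : @cgmfd R l n),
    [/\ (l <= k)%N, effective N,
      connected [set: M] -> connected [set: N],
      bclass M = bclass (pullback phi_full N)
      & l = 0%N -> forall g (x : M), act g x = x].
Proof.
pose K g := `[< forall x : M, act g x = x >].
have KP g : reflect (forall x : M, act g x = x) (K g) by exact: asboolP.
have [||A KA] := @F2_subspace k K.
- by apply/KP => x; exact: act0.
- by move=> g h /KP Kg /KP Kh; apply/KP => x; rewrite actD Kh Kg.
pose phi := col_base (cokermx A); pose psi := pinvmx phi.
have phi_full : row_full phi by exact: col_base_full.
(* [cokermx A] is [phi] times its row base, which is injective on rows and so does not enlarge the
   kernel. *)
have Kphi g : (g *m phi == 0) = K g.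
  rewrite KA submxE -[X in _ = (_ *m X == 0)]mulmx_base mulmxA.
  by rewrite -[in RHS](mul0mx _ (row_base (cokermx A))) (inj_eq (row_free_inj (row_base_free _))).
have psiK h : h *m psi *m phi = h by rewrite mulmxKpV ?submx_full.
have actK g (x : M) : act (g *m phi *m psi) x = act g x.
  have /KP Kg : K (g *m phi *m psi - g) by rewrite -Kphi mulmxBl psiK subrr.
  by rewrite -[X in act X x](subrK g) addrC actD Kg.
have isoN : isolated_fixpoints (pullback_gmfd psi M).
  have fixE x : @fixpoints R _ n _ (pullback_gmfd psi M) x -> @fixpoints R k n _ M x.
    by move=> fx g; rewrite -actK; exact: fx.
  move=> x fx; apply: filterS (cgmfd_isolated (fixE x fx)) => y yx fy.
  exact/yx/fixE.
pose N : cgmfd _ n := CGMfd isoN.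
exists (\rank (cokermx A)), phi, phi_full, N; split => //.
- exact: rank_leq_row.
- move=> h hN; have /KP : forall x : M, act (h *m psi) x = x by exact: hN.
  by rewrite -Kphi psiK => /eqP.
- apply: (@bclass_diffeo R k n M (pullback phi_full N) id) => //.
  + exact: smooth_immersion_id.
  + by move=> x; exists x.
  + by move=> g x /=; rewrite actK.
- move=> l0 g; apply/KP; rewrite -Kphi; apply/eqP/rowP => i.
  by have := ltn_ord i; rewrite [X in (_ < X)%N]l0.
Qed.

End Kernels.

(** * Decomposition into connected pieces *)

Section ClopenParts.
Context {R : realType}.

Lemma cinv_continuous d (M : mfd [set: 'rV[R]_d]) (c : @chart R M d) x :
  atlas c -> cdom c x -> {for c x, continuous (cinv c)}.
Proof.
move=> ac cx B; rewrite (chartK (atlas_chart ac) cx) => nB.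
exact: (near_chart ac cx nB).
Qed.

Section ClopenManifold.
Variables (d : nat) (M : mfd [set: 'rV[R]_d]) (A : set M).

Definition part_chart (a0 : A) (c : @chart R M d) : @chart R A d :=
  Chart [set x : A | cdom c (set_val x)] (fun x => c (set_val x))
    (fun v => insubd a0 (cinv c v)).

(* The point [a0] only serves as a value of the inverse outside its domain, so
   that the atlas is empty when [A] is. *)
Definition part_atlas : set (@chart R A d) :=
  [set c | exists a0 c0, atlas c0 /\ c = part_chart a0 c0].

Lemma part_chart_image a0 c :
  part_chart a0 c @` cdom (part_chart a0 c) = c @` (cdom c `&` A).
Proof.
apply/seteqP; split=> [_ [x cx <-]|_ [x [cx Ax] <-]].
  by exists (set_val x) => //; split=> //; exact: set_valP.
by exists (SigSub (mem_set Ax)).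
Qed.

Lemma part_cinvE a0 c v : atlas c -> (c @` (cdom c `&` A)) v ->
  set_val (cinv (part_chart a0 c) v) = cinv c v.
Proof.
move=> ac [x [cx Ax] <-]; rewrite /= set_valE insubdK// (chartK (atlas_chart ac) cx).
exact: mem_set.
Qed.

Hypotheses (oA : open A) (cA : closed A).

Lemma part_is_chart c : part_atlas c -> is_chart setT c.
Proof.
move=> [a0 [c0 [ac ->]]]; split.
- apply: (open_comp (f := set_val : A -> M) (D := cdom c0)) => [x _|].
    exact: set_val_continuous.
  exact: (chart_open (atlas_chart ac)).
- rewrite part_chart_image; exists (c0 @` (cdom c0 `&` A)); last by rewrite setIT.
  exact: chart_image_open.
- move=> x cx; apply: val_inj; rewrite -[LHS]/(set_val (cinv (part_chart a0 c0) _)).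
  rewrite part_cinvE//; first exact: (chartK (atlas_chart ac) cx).
  by exists (set_val x) => //; split=> //; exact: set_valP.
- move=> x cx; apply: (@continuous_comp A _ _ set_val c0).
    exact: set_val_continuous.
  exact: (chart_continuous (atlas_chart ac)).
- rewrite part_chart_image; apply/subspace_continuousP => v iv.
  apply: cvg_set_type; rewrite part_cinvE//.
  have [x [cx Ax] xv] := iv; subst v => B nB.
  apply: (@filterS _ (nbhs (c0 x)) _ _ _ _ (cinv_continuous ac cx nB)) => w Bw iw.
  by rewrite /= [X in B X](part_cinvE a0 ac iw).
Qed.

Lemma part_atlas_cover x : exists2 c, part_atlas c & cdom c x.
Proof.
have [c ac cx] := atlas_cover (set_val x).
by exists (part_chart x c) => //; exists x, c.
Qed.

Lemma part_atlas_smooth c c' : part_atlas c -> part_atlas c' ->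
  smooth_on (c @` (cdom c `&` cdom c')) (c' \o cinv c).
Proof.
move=> [a0 [c0 [ac ->]]] [a0' [c0' [ac' ->]]].
apply: sub_smooth_on (atlas_smooth ac ac').
  by move=> _ [x [cx c'x] <-]; exists (set_val x).
move=> _ [x [cx c'x] <-]; rewrite /= -[insubd _ _]/(cinv (part_chart a0 c0) _).
by rewrite part_cinvE//; exists (set_val x) => //; split=> //; exact: set_valP.
Qed.

Definition part_mfd : mfd [set: 'rV[R]_d].
Proof.
refine (@Mfd R d setT A part_atlas part_is_chart part_atlas_cover part_atlas_smooth _ _).
- exact/set_type_hausdorff/mfd_hausdorff.
- by apply: set_type_compact; apply: (@subclosed_compact _ _ setT) => //; exact: mfd_compact.
Defined.

Lemma chartwise_part_val : chartwise idfun (set_val : part_mfd -> M).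
Proof.
split; first exact: set_val_continuous.
move=> _ x [a0 [c [ac ->]]] cx; exists c; split => //.
have nA : nbhs (set_val x) A by apply: open_nbhs_nbhs; split=> //; exact: set_valP.
apply: filterS (chart_image_nbhs ac cx nA) => v iv.
exact: part_cinvE.
Qed.

Lemma smooth_immersion_part e (P : mfd [set: 'rV[R]_e]) (f : P -> part_mfd) :
  smooth_immersion ((set_val : part_mfd -> M) \o f) -> smooth_immersion f.
Proof.
move=> [[cf sf] imf]; split; first split.
- by move=> x; apply: (@cvg_set_type _ _ _ (nbhs x)); exact: cf.
- by move=> c _ ac [a0 [c' [ac' ->]]]; exact: sf.
- by move=> c _ x ac [a0 [c' [ac' ->]]]; exact: imf.
Qed.

Lemma smooth_immersion_part_val e (K : set 'rV[R]_e) (P : mfd K) (f : M -> P) :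
  smooth_immersion f -> smooth_immersion (f \o (set_val : part_mfd -> M)).
Proof.
exact: smooth_immersion_precomp (coordinate_inj_id _) chartwise_part_val.
Qed.

End ClopenManifold.

Lemma actN k d (H : set 'rV[R]_d) (M : gmfd k H) g (x : M) : act g (act g x) = x.
Proof.
rewrite -actD (_ : g + g = 0) ?act0//; apply/rowP => i; rewrite !mxE.
by apply/eqP; case: (g 0 i) => [[|[|]]].
Qed.

Lemma smooth_immersion_act k d (M : gmfd k [set: 'rV[R]_d]) g :
  smooth_immersion (@act _ _ _ _ M g).
Proof.
apply: (@diffeo_smooth_immersion R d d M M (act g) (act g));
  [exact: act_smooth|exact: act_smooth|exact: actN].
Qed.

Section ClopenAction.
Variables (k d : nat) (M : gmfd k [set: 'rV[R]_d]) (A : set M).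
Hypotheses (oA : open A) (cA : closed A).
Hypothesis (iA : forall g x, A x -> A (act g x)).

Definition part_gmfd : gmfd k [set: 'rV[R]_d].
Proof.
refine (@GMfd R k d setT (part_mfd oA cA)
  (fun g x => SigSub (mem_set (iA g (set_valP x)))) _ _ _).
- by move=> x; apply: val_inj; rewrite /= act0.
- by move=> g h x; apply: val_inj; rewrite /= actD.
- move=> g; apply: (fun H => proj1 (@smooth_immersion_part _ M A oA cA _ (part_mfd oA cA) _ H)).
  exact: (smooth_immersion_part_val oA cA (smooth_immersion_act M g)).
Defined.

End ClopenAction.

Definition part k n (M : @cgmfd R k n) (A : set M) (oA : open A) (cA : closed A)
  (iA : forall g x, A x -> A (act g x)) : @cgmfd R k n.
Proof.
refine (@CGMfd R k n (part_gmfd oA cA iA) _) => x fx.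
have fixE (y : part_gmfd oA cA iA) : @fixpoints R k n _ (part_gmfd oA cA iA) y ->
    @fixpoints R k n _ M (set_val y).
  by move=> fy g; exact: (congr1 val (fy g)).
have := cgmfd_isolated (fixE x fx) => isx.
apply: (@filterS _ (nbhs x) _ _ _ _ (@set_val_continuous _ A x _ isx)) => y yx fy.
by apply: val_inj; apply: yx; exact: fixE.
Defined.

End ClopenParts.

(** * Connected components, and decomposition along invariant clopen subsets *)

Section Components.
Context {R : realType}.

Lemma set_type_connected (T : topologicalType) (A : set T) :
  connected A -> connected [set: A].
Proof.
move=> cA B [b Bb] [_ [V oV <-] BV] [F cF BF].
have [V' oV' FV'] : exists2 V', open V' & ~` F = set_val @^-1` V'.
  by have [V' ? <-] : open (~` F) by [exact: closed_openC]; exists V'.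
rewrite setTI in BV; rewrite setTI in BF.
have AB : set_val @` B = A.
  apply: cA; first by exists (set_val b), b.
    exists V => //; rewrite BV; apply/seteqP; split=> [_ [x Vx <-]|x [Ax Vx]].
      by split=> //; exact: set_valP.
    by exists (SigSub (mem_set Ax)).
  exists (~` V'); first exact: open_closedC.
  rewrite BF -[F]setCK FV'; apply/seteqP; split=> [_ [x Vx <-]|x [Ax Vx]].
    by split=> //; exact: set_valP.
  by exists (SigSub (mem_set Ax)).
apply/seteqP; split=> // x _.
have [y By /val_inj <- //] : (set_val @` B) (set_val x).
by rewrite AB; exact: set_valP.
Qed.

Lemma connected_clopen_sub (T : topologicalType) (A B : set T) x :
  connected A -> open B -> closed B -> A x -> B x -> A `<=` B.
Proof.
move=> cA oB cB Ax Bx; suff <- : A `&` B = A by move=> y [].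
by apply: cA; [exists x|exists B|exists B].
Qed.

(** The image of a chart contains a ball around the image of [y]. Straight segments in this ball,
    carried back by the chart, join [y] to all nearby points. *)
Lemma connected_component_open d (M : mfd [set: 'rV[R]_d]) (x : M) :
  open (connected_component [set: M] x).
Proof.
rewrite openE => y xy; have [c ac cy] := atlas_cover y.
have oW : open (c @` cdom c).
  by rewrite -[cdom c]setIT; apply: chart_image_open => //; exact: openT.
have /nbhs_ballP[e /= e0 eW] : nbhs (c y) (c @` cdom c).
  by apply: open_nbhs_nbhs; split=> //; exists y.
have nB : nbhs y (cdom c `&` c @^-1` ball (c y) e).
  apply: filterI; first by apply: open_nbhs_nbhs; split=> //; exact: (chart_open (atlas_chart ac)).
  by apply: (chart_continuous (atlas_chart ac) cy); exact: nbhsx_ballx.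
apply: filterS nB => z [cz yz].
rewrite (same_connected_component xy).
pose gam (s : R) := cinv c (c y + s *: (c z - c y)).
exists (gam @` `[0, 1]%classic); last first.
  exists 1; first by rewrite /= in_itv /= ler01 lexx.
  by rewrite /gam scale1r addrC subrK (chartK (atlas_chart ac)).
split=> //.
  exists 0; first by rewrite /= in_itv /= ler01 lexx.
  by rewrite /gam scale0r addr0 (chartK (atlas_chart ac)).
apply: connected_continuous_connected; first exact: segment_connected.
apply: continuous_in_subspaceT => s; rewrite inE /= in_itv /= => /andP[s0 s1].
have [u cu us] : (c @` cdom c) (c y + s *: (c z - c y)).
  apply: eW; move: yz; rewrite -ball_normE /= opprD addNKr normrN => yz.
  rewrite normrZ (ger0_norm s0); apply: le_lt_trans yz.
  by rewrite -[leRHS]mul1r -normrN opprB ler_wpM2r.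
apply: (@continuous_comp R 'rV[R]_d M (fun s => c y + s *: (c z - c y)) (cinv c)); last first.
  by rewrite -us; exact: cinv_continuous.
by apply: cvgD; [exact: cvg_cst|exact: scalel_continuous].
Qed.

Lemma act_continuous k d (M : gmfd k [set: 'rV[R]_d]) g : continuous (@act _ _ _ _ M g).
Proof. by have [] := @act_smooth R k d _ M g. Qed.

Lemma smooth_immersion_part_incl d (M : mfd [set: 'rV[R]_d]) (A B : set M)
    (oA : open A) (cA : closed A) (oB : open B) (cB : closed B)
    (f : part_mfd oA cA -> part_mfd oB cB) :
  (forall x, set_val (f x) = set_val x) -> smooth_immersion f.
Proof.
move=> fE; apply: smooth_immersion_part.
have -> : (set_val : part_mfd oB cB -> M) \o f = id \o (set_val : part_mfd oA cA -> M).
  by apply/funext => x; exact: fE.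
by apply: smooth_immersion_part_val; exact: smooth_immersion_id.
Qed.

Section Decomposition.
Variables (k n : nat) (M : @cgmfd R k n).
Implicit Types A B C : set M.

Lemma bclass_part_setT oA cA iA : bclass (@part R k n M setT oA cA iA) = bclass M.
Proof.
apply: (@bclass_diffeo R k n (part oA cA iA) M set_val).
- by apply: (smooth_immersion_part_val oA cA); exact: smooth_immersion_id.
- exact: val_inj.
- by move=> x; exists (SigSub (mem_set (I : setT x))).
- by [].
Qed.

Lemma bclass_part0 A oA cA iA : (forall x, ~ A x) ->
  bclass (@part R k n M A oA cA iA) = bzero R k n.
Proof.
move=> A0; symmetry.
apply: (@bclass_diffeo R k n (empty_cgmfd R k n) (part oA cA iA) (@from_empty R k n _)).
- exact: smooth_immersion_from_empty.
- by case=> -[].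
- by move=> x; case: (A0 (set_val x)); exact: set_valP.
- by move=> g [[]].
Qed.

Lemma bclass_part_split A B oA cA iA oC cC iC oD cD iD :
  bclass (@part R k n M A oA cA iA) =
  badd (bclass (@part R k n M (A `&` B) oC cC iC)) (bclass (@part R k n M (A `\` B) oD cD iD)).
Proof.
pose incl C (CA : C `<=` A) (x : C) : A := SigSub (mem_set (CA _ (set_valP x))).
have CA : A `&` B `<=` A by move=> x [].
have DA : A `\` B `<=` A by move=> x [].
rewrite badd_bclass; symmetry.
apply: (@bclass_diffeo R k n _ (part oA cA iA)
  (@copair2 R k n (part oC cC iC) (part oD cD iD) (part oA cA iA)
    (incl _ CA) (incl _ DA))).
- apply: smooth_immersion_copair2.
    exact: (@smooth_immersion_part_incl _ M _ _ oC cC oA cA).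
  exact: (@smooth_immersion_part_incl _ M _ _ oD cD oA cA).
- move=> [[] x] [[] y]; rewrite /copair2 /copair /= => /(congr1 val) /= E.
  + by have -> : x = y by exact: val_inj.
  + have [_ Bx] : (A `&` B) (set_val x) := set_valP x.
    have [_] : (A `\` B) (set_val y) := set_valP y.
    by case; rewrite -(E : set_val x = set_val y).
  + have [_ By] : (A `&` B) (set_val y) := set_valP y.
    have [_] : (A `\` B) (set_val x) := set_valP x.
    by case; rewrite (E : set_val x = set_val y).
  + by have -> : x = y by exact: val_inj.
- move=> x; have Ax : A (set_val x) := set_valP x.
  have [Bx|Bx] := pselect (B (set_val x)).
    exists (@inj1 R k n (part oC cC iC) (part oD cD iD) (SigSub (mem_set (conj Ax Bx)))).
    exact: val_inj.
  exists (@inj2 R k n (part oC cC iC) (part oD cD iD) (SigSub (mem_set (conj Ax Bx)))).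
  exact: val_inj.
- by move=> g [[] x]; apply: val_inj.
Qed.

Lemma part_connected A oA cA iA : connected A -> connected [set: @part R k n M A oA cA iA].
Proof. exact: set_type_connected. Qed.


End Decomposition.
(* [u] is a linear form with [u t = 1], [N] is invariant under its kernel and
   disjoint from its translate by [t]. The projection [P] onto the kernel along
   [t] lets the whole group act on [N], and the union of [N] and its translate is
   two copies of that manifold, exchanged according to [u]. *)
Section Unfolding.
Variables (k n : nat) (M : gmfd k [set: 'rV[R]_n]).
Variables (t : 'rV['F_2]_k) (u : 'cV['F_2]_k) (N : set M).
Hypotheses (oN : open N) (cN : closed N).
Hypothesis tu : (t *m u) 0 0 = 1.
Hypothesis iN : forall g x, g *m u = 0 -> N x -> N (act g x).
Hypothesis tN : forall x, N x -> ~ N (act t x).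

Let chi (g : 'rV['F_2]_k) : bool := (g *m u) 0 0 != 0.

Let chi0 : chi 0 = false.
Proof. by rewrite /chi mul0mx mxE eqxx. Qed.

Let chiD : {morph chi : g h / g + h >-> g (+) h}.
Proof.
move=> g h; rewrite /chi mulmxDl mxE.
by case: ((g *m u) 0 0) ((h *m u) 0 0) => [[|[|//]] ?] [[|[|//]] ?].
Qed.

(** On row vectors this is [g] plus [u(g)] times [t]. As [u(t) = 1] and [1 + 1 = 0], its values lie
    in the kernel of [u], which it fixes. *)
Let P : 'M['F_2]_k := 1%:M + u *m t.

Let gP g : g *m P = g + (if chi g then t else 0).
Proof.
rewrite mulmxDr mulmx1 mulmxA [g *m u]mx11_scalar mul_scalar_mx /chi.
case: ((g *m u) 0 0) => [[|[|//]] a2] /=.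
  by rewrite (_ : Ordinal a2 = 0) ?scale0r//; exact: val_inj.
by rewrite (_ : Ordinal a2 = 1) ?scale1r//; exact: val_inj.
Qed.

Let gPu (g : 'rV['F_2]_k) : g *m P *m u = 0.
Proof.
rewrite mulmxDr mulmx1 mulmxDl -!mulmxA [t *m u]mx11_scalar tu mulmx1.
by apply/rowP => i; rewrite !mxE; apply/eqP; case: (\sum_j _) => [[|[|]]].
Qed.

Let tt (b : bool) : 'rV['F_2]_k := if b then t else 0.

Let phi0 (x : M) : M := if `[< N x >] then x else act t x.

Let phi0_tt b z : N z -> phi0 (act (tt b) z) = z /\ `[< N (act (tt b) z) >] = ~~ b.
Proof.
rewrite /phi0 /tt => Nz; case: b => /=; last by rewrite act0; case: asboolP.
by case: asboolP => [/(tN Nz)//|_]; rewrite actN.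
Qed.

Let ttD b b' : tt b + tt b' = tt (b (+) b').
Proof.
rewrite /tt; case: b b' => [] [] //=; rewrite ?addr0 ?add0r//.
by apply/rowP => i; rewrite !mxE; apply/eqP; case: (t 0 i) => [[|[|]]].
Qed.

Let iNP g (x : pullback_gmfd P M) : N x -> N (act g x).
Proof. by move=> Nx; exact: iN. Qed.

(** A point of the union is uniquely [tt b] applied to a point of [N]; [eps] is the label [b] and
    [phi] the point of [N]. By [gphi], the group adds [chi g] to the label and acts on [N] through
    [P], which is the situation of [bounds_segment_prod]. *)
Lemma bounds_unfold oU cU iU :
  bounds (@part_gmfd R k n M [set x | N x \/ N (act t x)] oU cU iU).
Proof.
set B := part_gmfd _ _ _; pose C := @part_gmfd R k n (pullback_gmfd P M) N oN cN iNP.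
have Nphi (x : B) : N (phi0 (set_val x)).
  have : N (set_val x) \/ N (act t (set_val x)) := set_valP x.
  by rewrite /phi0; case: asboolP => // Nx [].
have xphi (x : B) : set_val x = act (tt (~~ `[< N (set_val x) >])) (phi0 (set_val x)).
  by rewrite /phi0 /tt; case: asboolP => /= _; rewrite ?act0 ?actN.
pose phi (x : B) : C := SigSub (mem_set (Nphi x)).
pose eps (x : B) := ~~ `[< N (set_val x) >].
have oNC : open (~` N) by exact: closed_openC.
have ceps (x : B) : \forall y \near x, `[< N (set_val y) >] = `[< N (set_val x) >].
  have [Nx|Nx] := pselect (N (set_val x)).
    have := @set_val_continuous _ _ x _ (open_nbhs_nbhs (conj oN Nx)).
    by apply: (@filterS _ (nbhs x)) => y Ny; rewrite !asboolT.
  have := @set_val_continuous _ _ x _ (open_nbhs_nbhs (conj oNC Nx)).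
  by apply: (@filterS _ (nbhs x)) => y Ny; rewrite !asboolF.
(* In the group this is [g + tt (eps x) = tt (chi g (+) eps x) + g *m P], the two occurrences of
   [tt (chi g)] on the right cancelling. *)
have gphi g (x : B) : act g (set_val x) =
    act (tt (chi g (+) eps x)) (act (g *m P) (phi0 (set_val x))).
  rewrite {1}xphi -!actD -/(eps x); congr act.
  by rewrite gP -/(tt (chi g)) addrCA ttD [_ (+) chi g]addbC addKb.
apply: (@bounds_segment_prod R k n B C chi eps phi chi0 chiD).
- apply: (@smooth_immersion_part R n (pullback_gmfd P M) N oN cN).
  apply: smooth_immersion_near => x.
  exists ((if `[< N (set_val x) >] then id else act t) \o (set_val : part_mfd oU cU -> M)).
    apply: smooth_immersion_part_val; case: asboolP => _.
      exact: smooth_immersion_id.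
    exact: smooth_immersion_act.
  apply: filterS (ceps x) => y Ny.
  by rewrite -Ny -[LHS]/(phi0 (set_val y)) /phi0; case: ifP.
- by move=> x; apply: filterS (ceps x) => y; rewrite /eps => ->.
- move=> x y exy /(congr1 val) /= pxy; apply: val_inj.
  by rewrite -[LHS]/(set_val x) xphi -/(eps x) exy pxy -xphi.
- move=> b z; pose z0 : M := set_val z; have Nz : N z0 := set_valP z.
  have Ux : [set x | N x \/ N (act t x)] (act (tt b) z0).
    by rewrite /= /tt; case: b; [right; rewrite actN; exact: Nz|left; rewrite act0; exact: Nz].
  have [pz ez] := phi0_tt b Nz.
  exists (SigSub (mem_set Ux)); last by apply: val_inj; rewrite /= pz.
  by rewrite /eps [set_val _]/= ez negbK.
- move=> g x; rewrite -[LHS]/(~~ `[< N (@act R k n setT M g (set_val x)) >]) gphi.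
  by have [_ ->] := phi0_tt (chi g (+) eps x) (iN (gPu g) (Nphi x)); rewrite negbK.
- move=> g x; apply: val_inj; rewrite -[LHS]/(phi0 (@act R k n setT M g (set_val x))) gphi.
  by have [-> _] := phi0_tt (chi g (+) eps x) (iN (gPu g) (Nphi x)).
Qed.

End Unfolding.

End Components.

(** * Orbits of components as the atoms of the decomposition *)

Section Orbits.
Context {R : realType} {k n : nat}.
Variable M : @cgmfd R k n.

Section ComponentOrbit.
Variable x0 : M.
Let C : set M := connected_component [set: M] x0.

(** The translate of [C] by [a] is connected and meets [C] in [act a z], hence lies in [C].
    Membership of [a] in the stabilizer of [C] can thus be tested at any single point. *)
Let act_component a z w : C z -> C (act a z) -> C w -> C (act a w).
Proof.
move=> Cz Caz Cw.
have cD : connected (@act R k n setT M a @` C).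
  apply: connected_continuous_connected; first exact: component_connected.
  by apply: continuous_subspaceT; exact: act_continuous.
have -> : C = connected_component [set: M] (act a z) by exact: same_connected_component.
by apply: (connected_component_max _ (@subsetT _ _) cD); [exists z|exists w].
Qed.

Let open_component : open C. Proof. exact: connected_component_open. Qed.

Let closed_component : closed C.
Proof. by apply: component_closed; exact: closedT. Qed.

Let Cx0 : C x0. Proof. exact: connected_component_refl. Qed.

(** With [S] the whole group this set is the orbit of [C], with [S] the kernel of a linear form it
    is the half [N] of the orbit. Elements being involutions, [C (act a y)] says that [y] lies in
    the translate of [C] by [a]. *)
Lemma open_translates (S : set 'rV['F_2]_k) :
  open [set y : M | exists2 a, S a & C (act a y)].
Proof.
rewrite (_ : mkset _ = \bigcup_(a in S) (@act R k n setT M a @^-1` C)).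
  apply: bigcup_open => a _; apply: open_comp => // y _; exact: act_continuous.
by apply/seteqP; split=> [y [a Sa ay]|y [a Sa ay]]; exists a.
Qed.

Lemma closed_translates (S : set 'rV['F_2]_k) :
  closed [set y : M | exists2 a, S a & C (act a y)].
Proof.
rewrite (_ : mkset _ = \bigcup_(a in S) (@act R k n setT M a @^-1` C)).
  apply: closed_bigcup => [|a _]; first exact: finite_finset.
  by apply: closed_comp => // y _; exact: act_continuous.
by apply/seteqP; split=> [y [a Sa ay]|y [a Sa ay]]; exists a.
Qed.

(** The vacuous condition [setT a] makes this an instance of [open_translates] and
    [closed_translates]. *)
Definition component_orbit : set M := [set y | exists2 a, setT a & C (act a y)].

Lemma component_orbit_invariant g y : component_orbit y -> component_orbit (act g y).
Proof.
by move=> [a _ Ca]; exists (a + g) => //; rewrite actD actN.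
Qed.

Lemma component_orbit_id : component_orbit x0.
Proof. by exists 0 => //; rewrite act0. Qed.

(** A nonempty invariant clopen subset of the orbit meets a translate of [C], hence [C] itself by
    invariance. By connectedness it contains [C], and then all translates. *)
Lemma component_orbit_min (B : set M) y : open B -> closed B ->
  (forall g x, B x -> B (act g x)) -> B `<=` component_orbit -> B y ->
  B = component_orbit.
Proof.
move=> oB cB iB BU By; apply/seteqP; split=> // z [a _ Ca].
have [b _ Cb] := BU y By.
have CB : C `<=` B.
  have cC : connected C by exact: component_connected.
  exact: (connected_clopen_sub cC oB cB Cb (iB b y By)).
by rewrite -(actN a z); apply/iB/CB.
Qed.

Lemma bclass_component_orbit oU cU iU :
  bclass (@part R k n M component_orbit oU cU iU) = bzero R k n \/
  connected component_orbit.
Proof.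
(* This is the stabilizer of [C], tested at [x0] by [act_component]. *)
pose H g := `[< C (act g x0) >].
have HP g : reflect (C (act g x0)) (H g) by exact: asboolP.
have [allH|] := pselect (forall g, H g).
  right; rewrite (_ : component_orbit = C); first exact: component_connected.
  apply/seteqP; split=> [y [a _ Ca]|y Cy]; last by exists 0; rewrite ?act0.
  by rewrite -(actN a y); apply: (act_component Cx0) => //; exact/HP.
move=> /existsNP[t /negP Ht]; left.
have [||u [Hu tu]] := F2_separation _ _ Ht.
- by apply/HP; rewrite act0.
- by move=> g h /HP Hg /HP Hh; apply/HP; rewrite actD; exact: (act_component Cx0).
pose N : set M := [set y | exists2 a, a *m u = 0 & C (act a y)].
have oN : open N by exact: open_translates.
have cN : closed N by exact: closed_translates.
have gg (g : 'rV['F_2]_k) : g + g = 0.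
  by apply/rowP => i; rewrite !mxE; apply/eqP; case: (g 0 i) => [[|[|]]].
have iN g x : g *m u = 0 -> N x -> N (act g x).
  move=> gu [a au Ca]; exists (a + g); first by rewrite mulmxDl au gu addr0.
  by rewrite actD actN.
(* If [a] and [b] in the kernel of [u] bring [x] and [act t x] into [C], then [b + t + a] stabilizes
   [C], so [u] vanishes on it. But its value there is [u(t) = 1]. *)
have tN x : N x -> ~ N (act t x).
  move=> [a au Ca] [b bu Cb].
  have E : act (b + t + a) (act a x) = act b (act t x).
    by rewrite -!actD -addrA gg addr0.
  have /HP/Hu : C (act (b + t + a) x0).
    by apply: (act_component Ca) => //; rewrite E.
  rewrite !mulmxDl au bu add0r addr0 => /rowP /(_ 0).
  by rewrite tu mxE.
have UE : component_orbit = [set x | N x \/ N (act t x)].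
  apply/seteqP; split=> [y [a _ Ca]|y [[a _ Ca]|[a _ Ca]]]; last 2 first.
  - by exists a.
  - by exists (a + t); rewrite ?actD.
  (* An element with [u(a) = 0] puts [y] in [N]; otherwise [a + t] is in the kernel and puts
     [act t y] in [N]. *)
  have [au|au] := eqVneq ((a *m u) 0 0) 0.
    by left; exists a => //; rewrite [a *m u]mx11_scalar au; apply/rowP => i; rewrite !mxE mul0rn.
  right; exists (a + t); last by rewrite actD actN.
  rewrite mulmxDl [a *m u]mx11_scalar [t *m u]mx11_scalar tu.
  move: ((a *m u) 0 0) au => b b0; apply/rowP => i.
  by rewrite !mxE ord1 /=; apply/eqP; case: b b0 => [[|[|]]].
apply: bounds_bclass0; move: oU cU iU; rewrite UE => oU cU iU.
exact: (bounds_unfold oN cN tu iN tN).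
Qed.

End ComponentOrbit.

(** This is an induction principle: a property of classes that holds for zero and is additive needs
    checking only on nonempty connected manifolds. Nonemptiness is explicit because [connected] also
    holds of the empty set. *)
Lemma bordism_decomposition (G : bordism_group R k n -> Prop) :
  G (bzero R k n) -> (forall x y, G x -> G y -> G (badd x y)) ->
  (forall N : @cgmfd R k n, connected [set: N] -> [set: N] !=set0 -> G (bclass N)) ->
  G (bclass M).
Proof.
move=> G0 GD Gc.
(* Quantifying over all invariant clopen subsets of [A] makes [P] stable under unions that need not
   be disjoint: [B] is cut into its parts inside and outside the first set. Orbits repeated in a
   finite cover then do no harm. *)
pose P (A : set M) := forall B oB cB iB, B `<=` A -> G (bclass (@part R k n M B oB cB iB)).
have P_orbit x : P (component_orbit x).
  move=> B oB cB iB BU; have [[y By]|B0] := pselect (exists y, B y); last first.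
    by rewrite bclass_part0// => y By; apply: B0; exists y.
  have BE := component_orbit_min oB cB iB BU By.
  move: oB cB iB; rewrite BE => oB cB iB.
  have [->//|cU] := bclass_component_orbit oB cB iB.
  apply: Gc; first exact: part_connected.
  by exists (SigSub (mem_set (component_orbit_id x))).
have PU A A' : open A -> closed A -> (forall g x, A x -> A (act g x)) ->
    P A -> P A' -> P (A `|` A').
  move=> oA cA iA PA PA' B oB cB iB BAA'.
  have oC : open (B `&` A) by exact: openI.
  have cC : closed (B `&` A) by exact: closedI.
  have iC g x : (B `&` A) x -> (B `&` A) (act g x).
    by move=> [Bx Ax]; split; [exact: iB|exact: iA].
  have oD : open (B `\` A) by rewrite setDE; apply: openI => //; exact: closed_openC.
  have cD : closed (B `\` A) by rewrite setDE; apply: closedI => //; exact: open_closedC.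
  have iD g x : (B `\` A) x -> (B `\` A) (act g x).
    by move=> [Bx Ax]; split; [exact: iB|move/(iA g); rewrite actN].
  rewrite (bclass_part_split oB cB iB oC cC iC oD cD iD); apply: GD.
    by apply: PA => x [].
  by apply: PA' => x [/BAA'[]].
have [s Ms] : exists s : seq M, forall y, exists2 x, x \in s & component_orbit x y.
  (* [compact_cover] would require a pointed space, while [M] may be empty. *)
  pose F := filter_from setT (fun s0 : seq M => [set s : seq M | {subset s0 <= s}]).
  have FF : Filter F.
    apply: filter_from_filter => [|s1 s2 _ _]; first by exists [::].
    exists (s1 ++ s2) => // s ss /=; split=> x xs; apply: ss;
      by rewrite mem_cat xs ?orbT.
  have := (compact_near_coveringP _).1 (@mfd_compact _ _ _ M) (seq M) F
    (fun s y => exists2 x, x \in s & component_orbit x y) FF.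
  case=> [x _|s0 _ /(_ s0 (fun x => id)) Ms]; last by exists s0 => y; exact: Ms.
  exists (component_orbit x, [set s : seq M | x \in s]).
    split; last by exists [:: x] => // s; apply; rewrite mem_head.
    apply: open_nbhs_nbhs; split; [exact: open_translates|exact: component_orbit_id].
  by move=> [y s] [/= xy xs]; exists x.
have Ps (r : seq M) : P [set y | exists2 x, x \in r & component_orbit x y].
  elim: r => [|x r IH]; first by move=> B oB cB iB B0; rewrite bclass_part0// => y /B0[].
  rewrite (_ : mkset _ = component_orbit x `|` [set y | exists2 x, x \in r & component_orbit x y]).
    apply: PU => //; [exact: open_translates|exact: closed_translates|].
    exact: component_orbit_invariant.
  apply/seteqP; split=> [y [z]|y [xy|[z zs zy]]].
  - by rewrite inE => /predU1P[->|zs]; [left|right; exists z].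
  - by exists x; rewrite // mem_head.
  - by exists z; rewrite // inE zs orbT.
rewrite -(@bclass_part_setT R k n M openT closedT (fun _ _ _ => I)).
by apply: (Ps s) => y _; exact: Ms.
Qed.

End Orbits.

(** * Finite generation *)

Section Homogeneous.
Context {R : realType} {k : nat}.

(** A chart with values in R^0 has at most one point in its domain, so points are open. They are
    also closed, and connectedness leaves a single one. *)
Lemma bclass_dim0 (N : @cgmfd R k 0) :
  connected [set: N] -> [set: N] !=set0 -> bclass N = bone R k.
Proof.
move=> cN [x0 _].
have injN (x : N) : x = x0.
  have [c ac cx] := atlas_cover x0.
  have cE : cdom c = [set x0].
    apply/seteqP; split=> [y cy|_ -> //]; rewrite /= -(chartK (atlas_chart ac) cy).
    by rewrite -(chartK (atlas_chart ac) cx); congr cinv; apply/rowP => -[].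
  have o1 : open [set x0] by rewrite -cE; exact: (chart_open (atlas_chart ac)).
  have c1 : closed [set x0].
    by apply: compact_closed; [exact: mfd_hausdorff|exact: compact_set1].
  exact: (connected_clopen_sub cN o1 c1 (I : setT x0) erefl I).
apply: (@bclass_diffeo R k 0 N (@Defs.cpoint R k) (fun=> 0)).
- apply: (@smooth_immersion_precomp R 0 0 0 setT idfun N point_mfd point_mfd (fun=> 0) id).
  + exact: coordinate_inj_id.
  + split; first by move=> x; exact: cvg_cst.
    move=> c x ac cx; exists point_chart; split => //; first by apply/rowP => -[].
    by apply: (@nearW _ (nbhs (c x))) => v; apply/rowP => -[].
  + exact: smooth_immersion_id.
- by move=> x y _; rewrite (injN x) (injN y).
- by move=> y; exists x0; apply/rowP => -[].
- by move=> g x; apply/rowP => -[].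
Qed.

(** Under a trivial action all points are fixed, so an isolated fixed point would be an isolated
    point of the manifold. But its chart image contains a ball, and thus the distinct point shifted
    by [e / 2] in all [n.+1] coordinates. *)
Lemma isolated_trivial_action n (N : @cgmfd R k n.+1) (x : N) :
  ~ (forall g (y : N), act g y = y).
Proof.
move=> trivN; have := @cgmfd_isolated _ _ _ N x (fun g => trivN g x) => isx.
have {isx} isx : \forall y \near x, y = x.
  by apply: filterS isx => y; apply; move=> g; exact: trivN.
have [c ac cx] := atlas_cover x.
have := chart_image_nbhs ac cx isx => /nbhs_ballP[e /= e0 He].
have /He [y [_ ->] E] : ball (c x) e (c x + const_mx (e / 2)).
  rewrite -ball_normE /= opprD addNKr normrN.
  apply: (@le_lt_trans _ _ (e / 2)); last by rewrite ltr_pdivrMr// ltr_pMr// ltr1n.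
  apply: mx_norm_le => [|i j]; first by rewrite divr_ge0// ltW.
  by rewrite mxE ger0_norm// divr_ge0// ltW.
have /rowP /(_ 0) : const_mx (e / 2) = 0 :> 'rV[R]_n.+1.
  by apply: (addrI (c x)); rewrite -E addr0.
by rewrite !mxE => /eqP; rewrite mulf_eq0 invr_eq0 pnatr_eq0 orbF gt_eqF.
Qed.

Definition homogeneous n (x : bordism_group R k n) : bfamily R k := fun m =>
  match n =P m with
  | ReflectT e => ecast j (bordism_group R k j) e x
  | ReflectF _ => bzero R k m
  end.

Lemma homogeneous_id n (x : bordism_group R k n) : homogeneous x n = x.
Proof. by rewrite /homogeneous; case: eqP => // e; rewrite eq_axiomK. Qed.

Lemma homogeneous_neq n m (x : bordism_group R k n) :
  n != m -> homogeneous x m = bzero R k m.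
Proof. by rewrite /homogeneous; case: eqP. Qed.

Lemma homogeneous_badd n (x y : bordism_group R k n) :
  homogeneous (badd x y) = fadd (homogeneous x) (homogeneous y).
Proof.
apply: functional_extensionality_dep => m; rewrite /homogeneous /fadd.
by case: eqP => [e|_]; [case: _ / e|rewrite baddx0].
Qed.

Lemma homogeneous_bzero n : homogeneous (bzero R k n) = fzero R k.
Proof.
apply: functional_extensionality_dep => m; rewrite /homogeneous.
by case: eqP => [e|//]; case: _ / e.
Qed.

Lemma homogeneous_bone : homogeneous (bone R k) = fone R k.
Proof.
by apply: functional_extensionality_dep => -[|m]; [exact: homogeneous_id|exact: homogeneous_neq].
Qed.

(** A finitely supported family equals one of its truncations, and these are built by adding one
    homogeneous term at a time. *)
Lemma generated_homogeneous r (s : 'I_r -> bfamily R k) x :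
  (forall n (y : bordism_group R k n), generated s (homogeneous y)) ->
  bordism_algebra x -> generated s x.
Proof.
move=> sH [N xN]; pose trunc m : bfamily R k := fun n => if (n < m)%N then x n else bzero R k n.
have -> : x = trunc N.
  by apply: functional_extensionality_dep => n; rewrite /trunc; case: ltnP => // /xN.
elim: {xN} N => [|m IH].
  by rewrite (_ : trunc 0%N = fzero R k) //; exact: generated_zero.
rewrite (_ : trunc m.+1 = fadd (trunc m) (homogeneous (x m))).
  by apply: generated_add => //; exact: sH.
apply: functional_extensionality_dep => n; rewrite /trunc /fadd ltnS leq_eqVlt.
have [->|nm] := eqVneq n m; first by rewrite ltnn homogeneous_id badd0x.
by rewrite homogeneous_neq 1?eq_sym// baddx0.
Qed.

Lemma effective_homogeneous n (N : @cgmfd R k n.+1) :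
  connected [set: N] -> effective N -> effective_algebra (homogeneous (bclass N)).
Proof.
move=> cN eN; split.
  by exists n.+2 => m nm; rewrite homogeneous_neq// ltn_eqF.
move=> m; have [<-|nm] := eqVneq n.+1 m.
  by rewrite homogeneous_id; exact: effective_class.
rewrite homogeneous_neq//; case: m nm => [_|m _]; first by left.
exact: effective_zero.
Qed.

End Homogeneous.

Lemma fpull_homogeneous (R : realType) k l (phi : 'M['F_2]_(k, l))
    (phi_full : row_full phi) n (x : bordism_group R l n) :
  fpull phi_full (homogeneous x) = homogeneous (bpull phi_full x).
Proof.
apply: functional_extensionality_dep => m; rewrite /fpull /homogeneous.
by case: eqP => [e|_]; [case: _ / e|exact: bpull_bzero].
Qed.

Lemma bordism_algebra_fpull (R : realType) k l (phi : 'M['F_2]_(k, l))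
    (phi_full : row_full phi) (x : bfamily R l) :
  bordism_algebra x -> bordism_algebra (fpull phi_full x).
Proof. by move=> [N xN]; exists N => n /xN; rewrite /fpull => ->; exact: bpull_bzero. Qed.

(** Degree 0 is treated apart: connected pieces are points there and contribute the unit. In
    positive degree a connected piece is the pullback of an effective one, and
    [isolated_trivial_action] excludes [l = 0]. *)
Lemma generated_by_pullbacks (R : realType) k r (s : 'I_r -> bfamily R k) :
  (forall l (phi : 'M['F_2]_(k, l)) (phi_full : row_full phi) x,
    (0 < l <= k)%N -> effective_algebra x -> generated s (fpull phi_full x)) ->
  forall x, bordism_algebra x -> generated s x.
Proof.
move=> sl x; apply: generated_homogeneous => {x} n x; rewrite -[x]breprK.
apply: (@bordism_decomposition R k n (brepr x) (fun y => generated s (homogeneous y))).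
- by rewrite homogeneous_bzero; exact: generated_zero.
- by move=> y z sy sz; rewrite homogeneous_badd; exact: generated_add.
move=> N cN N0; case: n N cN N0 {x} => [|n] N cN N0.
  by rewrite bclass_dim0// homogeneous_bone; exact: generated_one.
have [l [phi [phi_full [N' [lk eN' cN' -> l0]]]]] := effective_quotient N.
rewrite -bpull_bclass -fpull_homogeneous; apply: sl.
  rewrite lk andbT lt0n; apply/eqP => /l0 trivN.
  by have [x _] := N0; exact: (isolated_trivial_action x trivN).
by apply: effective_homogeneous => //; exact: cN'.
Qed.

Theorem theorem3p5 (R : realType) (k : nat) (k_ge1 : (1 <= k)%N) :
  ~ finitely_generated (@bordism_algebra R k) ->
  exists l : nat, (1 <= l <= k)%N /\
    ~ finitely_generated (@effective_algebra R l).
Proof.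
apply: contraPP => /forallNP fgZ.
(* The index [l] in ['I_k] stands for the rank [l.+1], so that the ranks from 1 to [k] form a finite
   type. *)
have {}fgZ (l : 'I_k) : finitely_generated (@effective_algebra R l.+1).
  by apply: contrapT => nfg; apply: (fgZ l.+1); split=> //=; exact: ltn_ord.
pose r l := sval (cid (fgZ l)).
pose s l : 'I_(r l) -> bfamily R l.+1 := sval (cid (svalP (cid (fgZ l)))).
have sP l : (forall i, effective_algebra (s l i)) /\
    forall x, effective_algebra x -> generated (s l) x.
  exact: (svalP (cid (svalP (cid (fgZ l))))).
pose T : finType := {p : {l : 'I_k & 'M['F_2]_(k, l.+1)} & 'I_(r (tag p))}.
(* An index consists of a rank, a matrix and a generator for that rank. Matrices that are not
   surjective are kept, with the harmless value [fzero], so that [T] is finite by construction. *)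
pose gen (q : T) : bfamily R k :=
  if @idP (row_full (tagged (tag q))) is ReflectT phi_full
  then fpull phi_full (s (tag (tag q)) (tagged q)) else fzero R k.
apply: (fun h nh => nh h); exists #|T|, (gen \o enum_val); split.
  move=> i; rewrite /= /gen; case: {-}_ / idP => [f|_]; last by exists 0%N.
  by apply: bordism_algebra_fpull; have [] := (sP (tag (tag (enum_val i)))).1 (tagged (enum_val i)).
apply: generated_by_pullbacks => -[//|l] phi phi_full x /= lk Zx.
pose l' := Ordinal lk.
have := (sP l').2 x Zx; apply: generated_fpull => i.
pose p := existT (fun l : 'I_k => 'M['F_2]_(k, l.+1)) l' phi.
pose q : T := existT (fun p : {l : 'I_k & 'M['F_2]_(k, l.+1)} => 'I_(r (tag p))) p i.
have <- : (gen \o enum_val) (enum_rank q) = fpull phi_full (s l' i).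
  rewrite /= enum_rankK /gen /=; case: {-}_ / idP => [f|//].
  by rewrite (bool_irrelevance f phi_full).
exact: generated_gen.
Qed.
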